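(* Let $D_8=\langle x,y\mid y^2=1=x^4,\ yxy=x^{-1}\rangle$ and consider the following six pairwise non-isomorphic simple Yetter-Drinfeld modules over $D_8$, each of dimension $2$: $M_1=M(\mathcal O_{x^2},\rho)$, $M_2=M(\mathcal O_x,\chi^2)$, $M_3=M(\mathcal O_y,\operatorname{sgn}\otimes\operatorname{sgn})$, $M_4=M(\mathcal O_y,\operatorname{sgn}\otimes\varepsilon)$, $M_5=M(\mathcal O_{xy},\operatorname{sgn}\otimes\operatorname{sgn})$, $M_6=M(\mathcal O_{xy},\operatorname{sgn}\otimes\varepsilon)$. Then the Nichols algebra $\mathcal B(M_i\oplus M_j\oplus M_k)$ is infinite-dimensional for all $1\le i<j<k\le6$.
   Context: All vector spaces are over an algebraically closed field $k$ of characteristic zero. For a finite group $G$, a conjugacy class $\mathcal O$, a fixed $s\in\mathcal O$ with centralizer $G^s$, and an irreducible representation $(\rho,V)$ of $G^s$, let $t_1=s,\dots,t_M$ enumerate $\mathcal O$ and choose $g_i\in G$ with $g_isg_i^{-1}=t_i$. The simple Yetter-Drinfeld module $M(\mathcal O,\rho)$ is $\bigoplus_{i}g_i\otimes V$, with $g_iv:=g_i\otimes v$, coaction $\delta(g_iv)=t_i\otimes g_iv$ and action $g\rhd(g_iv)=g_j(\rho(\gamma)v)$, where $gg_i=g_j\gamma$ with $\gamma\in G^s$. The braiding is $c(g_iv\otimes g_jw)=t_i\rhd(g_jw)\otimes g_iv$. $\mathcal O_s$ denotes the conjugacy class of $s$. For $D_8$: $\rho$ is the $2$-dimensional irreducible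 representation of $D_8=D_8^{x^2}$ (so $\rho(x^2)=-\mathrm{id}$); $\chi$ is the character of $D_8^x=\langle x\rangle$ with $\chi(x)$ a primitive $4$-th root of unity (so $\chi^2(x)=-1$); for $s\in\{y,xy\}$, $D_8^s=\langle s\rangle\times\langle x^2\rangle\cong Z_2\times Z_2$, and $\operatorname{sgn}\otimes\operatorname{sgn}$ (resp. $\operatorname{sgn}\otimes\varepsilon$) is the character with $s\mapsto-1,\ x^2\mapsto-1$ (resp. $s\mapsto-1,\ x^2\mapsto1$). $\mathcal B(V)$ denotes the Nichols algebra of $V$ in the category of Yetter-Drinfeld modules over $D_8$: the quotient of the tensor algebra $T(V)$ by the maximal graded Hopf ideal generated by homogeneous elements of degree at least $2$. *)

(* Defs.v *)
From HB Require Import structures.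
From mathcomp Require Export all_boot all_order all_algebra all_fingroup.
From mathcomp Require Export all_solvable all_field all_character.
From mathcomp Require Export finmap.finmap multinomials.monalg.

Set Implicit Arguments.
Unset Strict Implicit.
Unset Printing Implicit Defensive.

Import GRing.Theory.
Local Open Scope ring_scope.

(* {malg R[K]} is the free R-module with basis << u >>, u : K; the coefficient
   of << u >> in x is x@_u. *)

(* Linear extension of a map given on the basis. *)
Definition mext (R : comNzRingType) (K : choiceType) (W : lmodType R)
    (f : K -> W) (x : {malg R[K]}) : W :=
  \sum_(u <- msupp x) x@_u *: f u.

(* Component of degree a, for the grading in which << u >> has degree d u. *)
Definition mcomponent (R : comNzRingType) (K : choiceType) (D : eqType)
    (d : K -> D) (a : D) : {malg R[K]} -> {malg R[K]} :=
  mext (fun u => if d u == a then << u >> else 0).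

(* The tensor product of {malg R[K]} and {malg R[L]} is {malg R[K * L]}. *)
Definition mtensor (R : comNzRingType) (K L : choiceType)
    (x : {malg R[K]}) (y : {malg R[L]}) : {malg R[(K * L)%type]} :=
  mext (fun u => mext (fun v => << (u, v) >>) y) x.

Definition subspace (R : nzRingType) (W : lmodType R) (U : W -> Prop) : Prop :=
  U 0 /\ forall (a : R) u v, U u -> U v -> U (a *: u + v).

Definition span (R : nzRingType) (W : lmodType R) (S : W -> Prop) (w : W) :=
  forall U : W -> Prop, subspace U -> (forall v, S v -> U v) -> U w.

(* The quotient of W by the subspace I has finite dimension. *)
Definition finite_dim_quotient (R : nzRingType) (W : lmodType R)
    (I : W -> Prop) : Prop :=
  exists s : seq W, forall w, span (fun v => v \in s \/ I v) w.

Lemma mextE (R : comNzRingType) (K : choiceType) (W : lmodType R) (f : K -> W)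
    (x : {malg R[K]}) (d : {fset K}) :
  (msupp x `<=` d)%fset -> mext f x = \sum_(u <- d) x@_u *: f u.
Proof.
move=> le; rewrite /mext (big_fset_incl _ le) // => u _ /mcoeff_outdom ->.
by rewrite scale0r.
Qed.

Lemma mext_is_linear (R : comNzRingType) (K : choiceType) (W : lmodType R)
    (f : K -> W) : linear (mext f).
Proof.
move=> a x y; pose d := (msupp x `|` msupp y `|` msupp (a *: x + y))%fset.
have hx : (msupp x `<=` d)%fset by rewrite /d -fsetUA fsubsetUl.
have hy : (msupp y `<=` d)%fset by rewrite /d (fsetUC (msupp x)) -fsetUA fsubsetUl.
have hxy : (msupp (a *: x + y) `<=` d)%fset by rewrite /d fsubsetUr.
rewrite (mextE f hx) (mextE f hy) (mextE f hxy) scaler_sumr -big_split /=.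
by apply: eq_bigr => u _; rewrite mcoeffD mcoeffZ scalerDl scalerA.
Qed.

HB.instance Definition _ (R : comNzRingType) (K : choiceType) (W : lmodType R)
    (f : K -> W) :=
  GRing.isLinear.Build R {malg R[K]} W *:%R (mext f) (mext_is_linear f).

Lemma mextU (R : comNzRingType) (K : choiceType) (W : lmodType R) (f : K -> W)
    (u : K) : mext f << u >> = f u.
Proof.
rewrite (@mextE _ _ _ f _ [fset u]%fset) ?msuppU_le //.
by rewrite big_seq_fset1 mcoeffU eqxx scale1r.
Qed.

Lemma mextK (R : comNzRingType) (K : choiceType) (W W' : lmodType R)
    (f : K -> W) (g : {linear W -> W'}) (x : {malg R[K]}) :
  g (mext f x) = mext (g \o f) x.
Proof. by rewrite /mext linear_sum; apply: eq_bigr => u _; rewrite linearZ. Qed.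

Lemma eq_mext (R : comNzRingType) (K : choiceType) (W : lmodType R)
    (f g : K -> W) : f =1 g -> mext f =1 mext g.
Proof. by move=> fg x; rewrite /mext; apply: eq_bigr => u _; rewrite fg. Qed.

Lemma msupp_mext (R : comNzRingType) (K L : choiceType) (f : K -> {malg R[L]})
    (x : {malg R[K]}) (v : L) :
  v \in msupp (mext f x) -> exists2 u, u \in msupp x & v \in msupp (f u).
Proof.
move=> hv; have [/hasP[u xu fu]|/hasPn nh] :=
  boolP (has (fun u => v \in msupp (f u)) (msupp x)); first by exists u.
move: hv; rewrite -mcoeff_neq0 /mext raddf_sum big_seq big1 ?eqxx //= => u xu.
by rewrite mcoeffZ (mcoeff_outdom (nh u xu)) mulr0.
Qed.

Lemma malg_scaleAr (R : comNzRingType) (K : monomType) (c : R)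
    (x y : {malg R[K]}) : c *: (x * y) = x * (c *: y).
Proof.
apply/malgP => w; rewrite mcoeffZ mcoeffMl.
rewrite (mcoeffMlw _ (fsubset_refl (msupp x)) (msuppZ_le c y)).
rewrite mulr_sumr; apply: eq_bigr => u _; rewrite mulr_sumr.
by apply: eq_bigr => v _; rewrite mcoeffZ mulrnAr mulrCA.
Qed.

(* A finite-dimensional Yetter-Drinfeld module over the group algebra of gT, on
   the space {malg k[yd_base]} whose basis is homogeneous for the coaction
   << i >> |-> yd_deg i (x) << i >>; the action is g |> << i >> = yd_act g i. *)
Record ydModule (k : fieldType) (gT : finGroupType) := YDModule {
  yd_base : finType;
  yd_deg : yd_base -> gT;
  yd_act : gT -> yd_base -> {malg k[yd_base]};
  yd_act1 : forall i, yd_act 1%g i = << i >>;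
  yd_actM : forall g h i, yd_act (g * h)%g i = mext (yd_act g) (yd_act h i);
  yd_act_deg : forall g i j, j \in msupp (yd_act g i) ->
    yd_deg j = (g * yd_deg i * g^-1)%g
}.

Definition yd_dim (k : fieldType) (gT : finGroupType) (V : ydModule k gT) :=
  #|yd_base V|.

Definition yd_submodule (k : fieldType) (gT : finGroupType) (V : ydModule k gT)
    (U : {malg k[yd_base V]} -> Prop) : Prop :=
  [/\ subspace U,
      forall g v, U v -> U (mext (yd_act g) v) &
      forall g v, U v -> U (mcomponent (@yd_deg _ _ V) g v)].

Definition yd_simple (k : fieldType) (gT : finGroupType) (V : ydModule k gT) :=
  (exists v : {malg k[yd_base V]}, v <> 0) /\
  forall U : {malg k[yd_base V]} -> Prop, yd_submodule U ->
    (forall v, U v -> v = 0) \/ (forall v, U v).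

Definition yd_isomorphic (k : fieldType) (gT : finGroupType)
    (V W : ydModule k gT) : Prop :=
  exists f : {linear {malg k[yd_base V]} -> {malg k[yd_base W]}},
  [/\ bijective f,
      forall g v, f (mext (yd_act g) v) = mext (yd_act g) (f v) &
      forall g v, f (mcomponent (@yd_deg _ _ V) g v)
                  = mcomponent (@yd_deg _ _ W) g (f v)].

Section DirectSum.
Context (k : fieldType) (gT : finGroupType) (V W : ydModule k gT).

Local Notation B := (yd_base V + yd_base W)%type.

Definition ydsum_inl : {malg k[yd_base V]} -> {malg k[B]} :=
  mext (fun i => << inl i >>).
Definition ydsum_inr : {malg k[yd_base W]} -> {malg k[B]} :=
  mext (fun i => << inr i >>).

Definition ydsum_deg (p : B) : gT :=
  match p with inl i => yd_deg i | inr i => yd_deg i end.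

Definition ydsum_act (g : gT) (p : B) : {malg k[B]} :=
  match p with
  | inl i => ydsum_inl (yd_act g i)
  | inr i => ydsum_inr (yd_act g i)
  end.

Fact ydsum_act1 p : ydsum_act 1%g p = << p >>.
Proof. by case: p => i /=; rewrite yd_act1 [LHS]mextU. Qed.

Fact ydsum_actM g h p :
  ydsum_act (g * h)%g p = mext (ydsum_act g) (ydsum_act h p).
Proof.
case: p => i /=; rewrite yd_actM /ydsum_inl /ydsum_inr !mextK;
by apply: eq_mext => j /=; rewrite mextU.
Qed.

Fact ydsum_act_deg g p q : q \in msupp (ydsum_act g p) ->
  ydsum_deg q = (g * ydsum_deg p * g^-1)%g.
Proof.
by case: p => i /= /msupp_mext[j /yd_act_deg <-];
  rewrite msuppU oner_eq0 inE => /eqP->.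
Qed.

Definition ydsum : ydModule k gT :=
  YDModule ydsum_act1 ydsum_actM ydsum_act_deg.

End DirectSum.

(* The module M(O, rho), O the conjugacy class of s: the basis element << (t, a) >>
   stands for g_t (x) e_a, where g_t = class_rep s t and (e_a) is the standard
   basis. MathComp representations satisfy rho (g h) = rho g *m rho h, so the
   left action of rho is on column vectors: rho(g) e_a = \sum_b rho g b a e_b.
   Explicitly g |> g_t v = g_t' (rho(c) v) with t' = class_conj g t,
   c = class_cocycle g t, and g g_t = g_t' c. *)
Section SimpleModule.
Context (k : fieldType) (gT : finGroupType) (s : gT) (n : nat).
Context (rho : mx_representation k 'C[s] n).

Definition class_type : finType := {t : gT | t \in (s ^: [set: gT])%g}.

Definition class_rep (t : class_type) : gT :=
  repr [set g : gT | (g * s * g^-1)%g == val t].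

Lemma class_repP t : (class_rep t * s * (class_rep t)^-1)%g = val t.
Proof.
case: t => t ht; rewrite /class_rep /=; case/imsetP: ht => g _ def_t.
have: g^-1%g \in [set g : gT | (g * s * g^-1)%g == t].
  by rewrite inE invgK def_t conjgE mulgA.
by move/mem_repr; rewrite inE => /eqP.
Qed.

Fact class_conj_subproof (g : gT) (t : class_type) :
  (g * val t * g^-1)%g \in (s ^: [set: gT])%g.
Proof.
apply/imsetP; exists (g * class_rep t)^-1%g; rewrite ?inE //.
by rewrite conjgE invgK -class_repP invMg !mulgA.
Qed.

Definition class_conj (g : gT) (t : class_type) : class_type :=
  Sub (g * val t * g^-1)%g (class_conj_subproof g t).

Definition class_cocycle (g : gT) (t : class_type) : gT :=
  ((class_rep (class_conj g t))^-1 * g * class_rep t)%g.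

Definition simple_deg (p : class_type * 'I_n) : gT := val p.1.

Definition simple_act (g : gT) (p : class_type * 'I_n) :
    {malg k[(class_type * 'I_n)%type]} :=
  \sum_(b < n) rho (class_cocycle g p.1) b p.2 *: << (class_conj g p.1, b) >>.

Lemma class_cocycle_cent g t : class_cocycle g t \in 'C[s]%g.
Proof.
rewrite /class_cocycle; set r := class_rep t; set r' := class_rep _.
have e : (g * (r * s * r^-1) * g^-1 = r' * s * r'^-1)%g by rewrite !class_repP.
apply/cent1P; rewrite /commute; apply: (mulgI r'); apply: (mulIg r^-1%g).
apply: (mulIg g^-1%g); rewrite !mulgA mulgV mul1g.
rewrite -!mulgA in e *; rewrite e !mulgA.
by rewrite !(mulgKV, mulgK) -?mulgA ?mulgV ?mulg1.
Qed.

Fact simple_act1 p : simple_act 1%g p = << p >>.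
Proof.
case: p => t a; rewrite /simple_act /=.
have ct : class_conj 1%g t = t by apply: val_inj; rewrite /= mul1g invg1 mulg1.
have c1 : class_cocycle 1%g t = 1%g by rewrite /class_cocycle ct mulg1 mulVg.
rewrite c1 repr_mx1 (bigD1 a) //= mxE eqxx scale1r ct big1 ?addr0 // => b ba.
by rewrite mxE (negPf ba) scale0r.
Qed.

Fact simple_actM g h p :
  simple_act (g * h)%g p = mext (simple_act g) (simple_act h p).
Proof.
case: p => t a; rewrite /simple_act /= linear_sum /=.
have ct : class_conj (g * h)%g t = class_conj g (class_conj h t).
  by apply: val_inj; rewrite /= invMg !mulgA.
have cc : class_cocycle (g * h)%g t
          = (class_cocycle g (class_conj h t) * class_cocycle h t)%g.
  by rewrite /class_cocycle ct !mulgA mulgK.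
under [RHS]eq_bigr => c _ do rewrite linearZ /= mextU /= scaler_sumr.
rewrite exchange_big /=; apply: eq_bigr => b _.
rewrite cc repr_mxM ?class_cocycle_cent // mxE scaler_suml ct.
by apply: eq_bigr => c _; rewrite scalerA mulrC.
Qed.

Fact simple_act_deg g p q : q \in msupp (simple_act g p) ->
  simple_deg q = (g * simple_deg p * g^-1)%g.
Proof.
rewrite -mcoeff_neq0 raddf_sum /= => nz.
suff [b] : exists b, q == (class_conj g p.1, b) by move/eqP->.
exists q.2; apply: contraNT nz => ne; apply/eqP/big1 => b _.
rewrite mcoeffZ mcoeffU; case: eqP => [e|]; last by rewrite mulr0.
by rewrite -e /= eqxx in ne.
Qed.

Definition ydsimple : ydModule k gT :=
  YDModule simple_act1 simple_actM simple_act_deg.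

End SimpleModule.

Section CharacterSquare.
Context (k : fieldType) (gT : finGroupType) (H : {group gT}).
Context (chi : mx_representation k H 1).

Fact sq_mx_repr : mx_repr H (fun g => chi g *m chi g).
Proof.
split=> [|g h Hg Hh]; first by rewrite repr_mx1 mulmx1.
rewrite repr_mxM // !mulmxA; congr (_ *m _); rewrite -!mulmxA; congr (_ *m _).
by apply/matrixP=> i j; rewrite !mxE !big_ord1 !ord1 mulrC.
Qed.

Definition sq_repr : mx_representation k H 1 := MxRepresentation sq_mx_repr.

End CharacterSquare.

Section Nichols.
Context (k : fieldType) (gT : finGroupType) (V : ydModule k gT).

Local Notation word := {fmonom yd_base V}.

(* T(V) is the free algebra on the basis of V, with basis the words in it. *)
Local Notation TV := {malg k[word]}.
Local Notation TTV := {malg k[(word * word)%type]}.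

Definition tgen : {malg k[yd_base V]} -> TV := mext (fun i => << fmu i >>).

Definition word_deg (w : word) : gT := (\prod_(i <- (w : seq _)) yd_deg i)%g.

Definition word_act (g : gT) (w : word) : TV :=
  \prod_(i <- (w : seq _)) tgen (yd_act g i).

(* The braided product (a (x) b)(c (x) d) = a (b_(-1) |> c) (x) b_(0) d. *)
Definition braided_mul (z z' : TTV) : TTV :=
  mext (fun p : word * word => mext (fun q : word * word =>
    mtensor (<< p.1 >> * word_act (word_deg p.2) q.1 : TV)
            (<< p.2 >> * << q.2 >> : TV)) z') z.

(* The algebra map T(V) -> T(V) (x) T(V) with v |-> v (x) 1 + 1 (x) v. *)
Definition coproduct : TV -> TTV :=
  mext (fun w : word =>
    foldr (fun i z => let v : TV := << fmu i >> in
             braided_mul (mtensor v 1 + mtensor 1 v) z)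
          (mtensor (1 : TV) (1 : TV)) w).

Definition counit (x : TV) : k := x@_(mone : word).

(* The braided anti-multiplicative map with S(v) = - v, i.e.
   S(v z) = (v_(-1) |> S(z)) S(v_(0)). *)
Definition antipode : TV -> TV :=
  mext (fun w : word =>
    foldr (fun i z => - (mext (word_act (yd_deg i)) z * << fmu i >>)) 1 w).

Definition homogeneous (n : nat) (x : TV) : Prop :=
  forall w : word, w \in msupp x -> size w = n.

Definition two_sided_ideal (I : TV -> Prop) : Prop :=
  [/\ subspace I, forall a x, I x -> I (a * x) & forall a x, I x -> I (x * a)].

Definition generated_ideal (X : TV -> Prop) (x : TV) : Prop :=
  forall I : TV -> Prop, two_sided_ideal I -> (forall z, X z -> I z) -> I x.

(* Graded Hopf ideals of T(V) in the category of Yetter-Drinfeld modules. *)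
Record graded_hopf_ideal (I : TV -> Prop) : Prop := GradedHopfIdeal {
  ghi_ideal : two_sided_ideal I;
  ghi_graded : forall n x, I x -> I (mcomponent (fun w : word => size w) n x);
  ghi_act : forall g x, I x -> I (mext (word_act g) x);
  ghi_coact : forall g x, I x -> I (mcomponent word_deg g x);
  ghi_coproduct : forall x, I x ->
    span (fun z => exists a b, (I a \/ I b) /\ z = mtensor a b) (coproduct x);
  ghi_counit : forall x, I x -> counit x = 0;
  ghi_antipode : forall x, I x -> I (antipode x)
}.

Definition generated_in_degree_ge2 (I : TV -> Prop) : Prop :=
  exists X : TV -> Prop,
    (forall x, X x -> exists2 n, (2 <= n)%N & homogeneous n x) /\
    (forall x, I x <-> generated_ideal X x).

(* The sum of all graded Hopf ideals generated in degrees at least 2; by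
   nichols_ideal_max below it is the largest one. *)
Definition nichols_ideal : TV -> Prop :=
  span (fun x => exists I : TV -> Prop,
    [/\ graded_hopf_ideal I, generated_in_degree_ge2 I & I x]).

Definition nichols_finite_dim : Prop := finite_dim_quotient nichols_ideal.

Lemma span_subspace (W : lmodType k) (S : W -> Prop) : subspace (span S).
Proof.
split=> [U [] //|a u v Su Sv U sU SU].
by case: (sU) => _; apply; [apply: Su|apply: Sv].
Qed.

Lemma span_incl (W : lmodType k) (S : W -> Prop) w : S w -> span S w.
Proof. by move=> Sw U _; apply. Qed.

Lemma span_linear (W W' : lmodType k) (f : {linear W -> W'}) (S : W -> Prop)
    (U : W' -> Prop) :
  subspace U -> (forall w, S w -> U (f w)) -> forall w, span S w -> U (f w).
Proof.
move=> [U0 UL] SU w Sw; apply: (Sw (fun w => U (f w))); last exact: SU.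
by split=> [|a u v Uu Uv]; rewrite ?linear0 // linearP; apply: UL.
Qed.

Lemma span_mono (W : lmodType k) (S S' : W -> Prop) :
  (forall w, S w -> S' w) -> forall w, span S w -> span S' w.
Proof. by move=> SS' w Sw U sU S'U; apply: Sw => // v /SS'; apply: S'U. Qed.

Lemma nichols_ideal_incl (I : TV -> Prop) :
  graded_hopf_ideal I -> generated_in_degree_ge2 I ->
  forall x, I x -> nichols_ideal x.
Proof. by move=> HI GI x Ix; apply: span_incl; exists I. Qed.

Lemma nichols_ideal_ideal : two_sided_ideal nichols_ideal.
Proof.
have [N0 NL] := span_subspace (fun x => exists I : TV -> Prop,
    [/\ graded_hopf_ideal I, generated_in_degree_ge2 I & I x]).
split; first exact: span_subspace.
  move=> a x Ix; apply: (Ix (fun x => nichols_ideal (a * x))).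
    split=> [|b u v Nu Nv]; first by rewrite mulr0.
    by rewrite mulrDr -malg_scaleAr; apply: NL.
  move=> z [I [HI GI Iz]].
  apply: (@nichols_ideal_incl I) => //.
  by case: (ghi_ideal HI) => _ + _; apply.
move=> a x Ix; apply: (Ix (fun x => nichols_ideal (x * a))).
  split=> [|b u v Nu Nv]; first by rewrite mul0r.
  by rewrite mulrDl -scalerAl; apply: NL.
move=> z [I [HI GI Iz]]; apply: (@nichols_ideal_incl I) => //.
by case: (ghi_ideal HI) => _ _; apply.
Qed.

Theorem nichols_ideal_max :
  [/\ graded_hopf_ideal nichols_ideal, generated_in_degree_ge2 nichols_ideal &
      forall I : TV -> Prop, graded_hopf_ideal I -> generated_in_degree_ge2 I ->
        forall x, I x -> nichols_ideal x].
Proof.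
split; last by move=> I HI GI; apply: nichols_ideal_incl.
- have sN := span_subspace (fun x => exists I : TV -> Prop,
    [/\ graded_hopf_ideal I, generated_in_degree_ge2 I & I x]).
  split; first exact: nichols_ideal_ideal.
  + move=> n; apply: span_linear => // x [I [HI GI Ix]].
    by apply: (@nichols_ideal_incl I) => //; apply: ghi_graded.
  + move=> g; apply: span_linear => // x [I [HI GI Ix]].
    by apply: (@nichols_ideal_incl I) => //; apply: ghi_act.
  + move=> g; apply: span_linear => // x [I [HI GI Ix]].
    by apply: (@nichols_ideal_incl I) => //; apply: ghi_coact.
  + apply: span_linear; first exact: span_subspace.
    move=> x [I [HI GI Ix]]; apply: span_mono (ghi_coproduct HI Ix).
    move=> _ [a [b [Iab ->]]]; exists a, b; split=> //.
    by case: Iab; [left|right]; apply: (@nichols_ideal_incl I).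
  + move=> x Nx; apply: (Nx (fun x => counit x = 0)) => [|z [I [HI _]]].
      rewrite /counit; split=> [|a u v u0 v0]; first exact: mcoeff0.
      by rewrite mcoeffD mcoeffZ u0 v0 mulr0 addr0.
    exact: ghi_counit.
  + apply: span_linear => // x [I [HI GI Ix]].
    by apply: (@nichols_ideal_incl I) => //; apply: ghi_antipode.
- exists (fun x => nichols_ideal x /\ exists2 n, (2 <= n)%N & homogeneous n x).
  split=> [x [_]//|x]; split=> [Nx J idJ XJ|].
    apply: Nx => [|z [I [HI GI Iz]]]; first by case: idJ.
    have [X [homX genX]] := GI; have /genX := Iz; apply=> // u Xu.
    apply: XJ; split; last exact: homX.
    apply: (@nichols_ideal_incl I) => //; apply/genX => I' _; exact.
  by apply=> [|z [] //]; apply: nichols_ideal_ideal.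
Qed.

End Nichols.

(* Main.v *)
From HB Require Import structures.
From Stdlib Require Import Classical_Prop.
Require Import Defs.
From mathcomp Require Import ring.

(** Why the Nichols algebras of the triples are infinite-dimensional.

    Each basis vector b of V gives an operator on the tensor algebra T(V), the
    part of degree (n, 1) of the coproduct read on b.  It is a skew derivation,
    d(x y) = x d(y) + d(x) (deg b . y), it preserves the Nichols ideal N because
    N is a coideal living in degrees at least 2, and 1 is not in N
    [nichols_ideal_pder, nichols_ideal_not1].  Hence a composite E of such
    operators with E(z^m) = m c z^(m-1), c <> 0, makes the powers of z linearly
    independent modulo N in characteristic 0 [lowering_infinite].

    To find z, fix a Yetter-Drinfeld submodule spanned by a set P of basis
    vectors.  The elements killed by all d_b, b in P, and by all their
    translates, form a G-stable subalgebra K.  It contains the generators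
    outside P, and with r it contains the braided commutator
    ad u (r) = u r - (deg u . r) u of every homogeneous u in the span of P
    [coinv_bracket].  On K a composite d_u .. d_v d_w, with u, .., v in P and w
    arbitrary, is again a skew derivation [skew_comp]: these are the operators
    dual to iterated commutators.  Two situations give E.
    - If D is skew for g on K, D(z) = c is a nonzero scalar and g fixes z, then
      D(z^m) = m c z^(m-1) [power_infinite].  In the language of root vectors, z
      has self-braiding 1.
    - If n and p in K have inverse degrees, are eigenvectors of g = deg n with
      distinct eigenvalues, and have dual operators Dn and Dp, then
      z = n p - (g . p / p) p n satisfies Dn Dp (z^m) = m c z^(m-1)
      [pair_infinite]: the commutator of the two simple roots of a diagram of
      type affine A_1.

    All six modules have a basis u0, u1 permuted up to scalars by D_8.  M_1 is
    central (degrees x^2, x^2), M_2 a rotation module (degrees x, x^-1), M_3 and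
    M_4 reflection modules for y on which x^2 acts by -1 and 1, and M_5, M_6
    likewise for x y.  Simplicity, dimension and the absence of isomorphisms are
    read off these bases.

    In the pairs {M_1, M_2}, {M_3, M_6}, {M_4, M_5} the squared braiding has
    eigenvalues i and -i.  The commutators ad M_i (M_j) then contain n and p of
    degrees x and x^-1 on which x acts by i and -i, up to order, so the second
    criterion applies.  This settles the twelve triples that contain such a
    pair.  The eight others take one module from each pair.
    - In {M_1, M_3, M_5}, {M_1, M_4, M_6}, {M_2, M_3, M_4}, {M_2, M_5, M_6} the
      commutators of the two reflection modules contain a copy of the rotation
      module, respectively of the central module.  With the third module it
      behaves as the pair {M_1, M_2}.
    - In {M_1, M_3, M_4}, {M_1, M_5, M_6}, {M_2, M_3, M_5}, {M_2, M_4, M_6} a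
      double commutator z = ad u (ad v (w)), with one factor from each module,
      has degree 1 in D_8, so the first criterion applies once D(z) <> 0 is
      checked: z is the imaginary root of a triangle, affine A_2 at q = -1.

    The automorphism fixing x and mapping y to x y exchanges M_3 with M_5 and
    M_4 with M_6; applying a lemma to the generators x, x y saves half of the
    computations. *)

Set Implicit Arguments.
Unset Strict Implicit.
Unset Printing Implicit Defensive.

Import GRing.Theory.
Local Open Scope ring_scope.

(** * The tensor algebra and its skew derivations *)
Lemma linear_basis_eq (R : comNzRingType) (K : choiceType) (W : lmodType R)
    (f g : {linear {malg R[K]} -> W}) :
  (forall u, f << u >> = g << u >>) -> f =1 g.
Proof.
move=> fg x; rewrite (monalgE x) !linear_sum; apply: eq_bigr => u _ /=.
have -> : << x@_u *g u >> = x@_u *: << u >> :> {malg R[K]}.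
  by apply/malgP=> v; rewrite mcoeffZ !mcoeffU mulr_natr.
by rewrite !linearZ fg.
Qed.

Lemma subspace_basis (R : comNzRingType) (K : choiceType)
    (P : {malg R[K]} -> Prop) :
  subspace P -> (forall u, P << u >>) -> forall x, P x.
Proof.
move=> [P0 PL] PU x.
have -> : x = mext (fun u => << u >>) x.
  rewrite [LHS]monalgE /mext; apply: eq_bigr => u _.
  by apply/malgP=> v; rewrite mcoeffZ !mcoeffU mulr_natr.
rewrite /mext; elim: (msupp x : seq _) => [|u s IH]; first by rewrite big_nil.
by rewrite big_cons; apply: PL.
Qed.

Lemma mext_id (R : comNzRingType) (K : choiceType) (x : {malg R[K]}) :
  mext (fun u => << u >>) x = x.
Proof. by apply: (linear_basis_eq (f := mext _) (g := idfun)) => u; apply: mextU. Qed.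

Lemma mext_delta (R : comNzRingType) (K : choiceType) (W : lmodType R) (v : K)
    (c : W) (x : {malg R[K]}) :
  mext (fun u => if u == v then c else 0) x = x@_v *: c.
Proof.
rewrite /mext; case: (boolP (v \in msupp x)) => [vx|vx].
  rewrite (bigD1_seq v) //= eqxx big1 ?addr0 // => u /negPf->.
  by rewrite scaler0.
rewrite (mcoeff_outdom vx) scale0r big_seq big1 // => u xu.
case: eqP => [uv|_]; last exact: scaler0.
by rewrite uv (negPf vx) in xu.
Qed.

Lemma mtensorUU (R : comNzRingType) (K L : choiceType) (u : K) (v : L) :
  mtensor << u >> << v >> = << (u, v) >> :> {malg R[(K * L)%type]}.
Proof. by rewrite /mtensor !mextU. Qed.

Lemma leibniz_step (R : nzRingType) (A : lalgType R) (x w dv dw a b : A) (c : R) :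
  x * (w * dv + dw * a) + c *: (b * a) = x * w * dv + (x * dw + c *: b) * a.
Proof. by rewrite mulrDr mulrDl !mulrA -scalerAl addrA. Qed.

Section TensorAlgebra.
Context (k : fieldType) (gT : finGroupType) (V : ydModule k gT).

Local Notation B := (yd_base V).
Local Notation word := {fmonom B}.
Local Notation TV := {malg k[word]}.
Local Notation TTV := {malg k[(word * word)%type]}.
Local Notation U := {malg k[B]}.

(** The bases of T(V) and of its tensor square, under opaque names: words are
    then compared as words and not letter by letter. *)
Definition tword (w : word) : TV := << w >>.
Definition tpair (p : word * word) : TTV := << p >>.

Lemma tensor_ext (W : lmodType k) (f g : {linear TV -> W}) :
  (forall w, f (tword w) = g (tword w)) -> f =1 g.
Proof. exact: linear_basis_eq. Qed.

Lemma tensor2_ext (W : lmodType k) (f g : {linear TTV -> W}) :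
  (forall p, f (tpair p) = g (tpair p)) -> f =1 g.
Proof. exact: linear_basis_eq. Qed.

Lemma tword_subspace (P : TV -> Prop) :
  subspace P -> (forall w, P (tword w)) -> forall x, P x.
Proof. exact: subspace_basis. Qed.

Lemma mext_tword (W : lmodType k) (f : word -> W) w : mext f (tword w) = f w.
Proof. exact: mextU. Qed.

Lemma mext_tpair (W : lmodType k) (f : word * word -> W) p :
  mext f (tpair p) = f p.
Proof. exact: mextU. Qed.

Lemma mtensor_tword u v : mtensor (tword u) (tword v) = tpair (u, v).
Proof. exact: mtensorUU. Qed.

Lemma mcoeff_tword u v : (tword u)@_v = (u == v)%:R.
Proof. exact: mcoeffU1. Qed.

Lemma tword1 : tword mone = 1.
Proof. by []. Qed.

Lemma twordM (u v : word) : tword u * tword v = tword (mmul u v) :> TV.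
Proof. by rewrite /tword malgM_def fgmulUU mulr1. Qed.
#[local] Opaque tword tpair.

Lemma word_ind (P : word -> Prop) :
  P mone -> (forall i w, P w -> P (mmul (fmu i) w)) -> forall w, P w.
Proof.
move=> P1 PM [s]; elim: s => [|i s IH].
  by have := P1; rewrite /mone /= fmoneE.
by have := PM i _ IH; rewrite /mmul /= fmmulE fmuE.
Qed.

Definition tact (g : gT) : TV -> TV := mext (@word_act _ _ V g).
HB.instance Definition _ (g : gT) := GRing.Linear.on (tact g).

HB.instance Definition _ := GRing.Linear.on (@tgen k gT V).

Lemma tactP g : linear (tact g). Proof. exact: linearP. Qed.

Lemma tactZ g c x : tact g (c *: x) = c *: tact g x. Proof. exact: linearZ. Qed.

Lemma word_act1 g : word_act g (mone : word) = 1.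
Proof. by rewrite /word_act fm1 big_nil. Qed.

Lemma word_actM g (u v : word) :
  word_act g (mmul u v) = word_act g u * word_act g v.
Proof. by rewrite /word_act fmM big_cat. Qed.

Lemma word_actU g i : word_act g (fmu i : word) = tgen (yd_act g i).
Proof. by rewrite /word_act fmU big_seq1. Qed.

Lemma malg_bilinear_eq (f g : TV -> TV -> TV) :
  (forall x, linear (f x)) -> (forall y, linear (f^~ y)) ->
  (forall x, linear (g x)) -> (forall y, linear (g^~ y)) ->
  (forall u v : word, f (tword u) (tword v) = g (tword u) (tword v)) ->
  forall x y, f x y = g x y.
Proof.
move=> fr fl gr gl fg x.
have lin0 (h : TV -> TV) : linear h -> h 0 = 0.
  by move=> hl; have := hl (-1) 0 0; rewrite scaleN1r addr0 oppr0 scaleN1r addNr.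
apply: tword_subspace.
  split=> [|a y z Py Pz]; first by rewrite !lin0.
  by rewrite fr gr Py Pz.
move=> v; move: x; apply: tword_subspace.
  split=> [|a y z Py Pz]; first by rewrite (lin0 _ (fl _)) (lin0 _ (gl _)).
  by rewrite fl gl Py Pz.
by move=> u; apply: fg.
Qed.

Lemma tactM g (a b : TV) : tact g (a * b) = tact g a * tact g b.
Proof.
move: a b; apply: (malg_bilinear_eq (f := fun a b => tact g (a * b))
                     (g := fun a b => tact g a * tact g b)).
- by move=> x c y z; rewrite mulrDr -malg_scaleAr tactP.
- by move=> x c y z; rewrite mulrDl -scalerAl tactP.
- by move=> x c y z; rewrite tactP mulrDr -malg_scaleAr.
- by move=> x c y z; rewrite tactP mulrDl -scalerAl.
by move=> u v; rewrite twordM /tact !mext_tword word_actM.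
Qed.

Lemma tact_one g : tact g 1 = 1.
Proof. by rewrite -tword1 /tact mext_tword word_act1. Qed.

Lemma tgenU i : @tgen k gT V << i >> = tword (fmu i).
Proof. exact: mextU. Qed.

Lemma tactU g w : tact g (tword w) = word_act g w.
Proof. exact: mext_tword. Qed.

Lemma tact_tgen g u : tact g (tgen u) = tgen (mext (@yd_act _ _ V g) u).
Proof.
apply: (linear_basis_eq (f := tact g \o @tgen _ _ V)
  (g := @tgen _ _ V \o mext (@yd_act _ _ V g))) => i /=.
by rewrite tgenU tactU [in RHS]mextU word_actU.
Qed.

Lemma word_act_id (w : word) : word_act 1%g w = tword w.
Proof.
elim/word_ind: w => [|i w IH]; first by rewrite word_act1.
by rewrite word_actM IH word_actU yd_act1 tgenU twordM.
Qed.

Lemma tact1 a : tact 1%g a = a.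
Proof.
apply: (tensor_ext (f := tact 1%g) (g := idfun)) => w /=.
by rewrite tactU word_act_id.
Qed.

Lemma tact_comp g h a : tact (g * h)%g a = tact g (tact h a).
Proof.
apply: (tensor_ext (f := tact (g * h)%g) (g := tact g \o tact h)) => w /=.
rewrite !tactU; elim/word_ind: w => [|i w IH].
  by rewrite !word_act1 tact_one.
rewrite !word_actM IH tactM !word_actU; congr (_ * _).
by rewrite tact_tgen yd_actM.
Qed.

(** Slicing the second factor of the tensor square by the coefficient of v. *)
Definition contract (v : word) : TTV -> TV :=
  mext (fun p : word * word => if p.2 == v then tword p.1 else 0).
HB.instance Definition _ v := GRing.Linear.on (contract v).

Lemma contractU v p :
  contract v (tpair p) = if p.2 == v then tword p.1 else 0.
Proof. exact: mext_tpair. Qed.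

Lemma contractD v : {morph contract v : x y / x + y}. Proof. exact: linearD. Qed.

Lemma contract_mtensor v a b : contract v (mtensor a b) = b@_v *: a.
Proof.
rewrite /mtensor (mextK _ (contract v)) -[in RHS](mext_id a).
rewrite (mextK _ (GRing.scale b@_v)); apply: eq_mext => u /=.
rewrite (mextK _ (contract v)) -mext_delta.
by apply: eq_mext => w; apply: mextU.
Qed.

HB.instance Definition _ := GRing.Linear.on (@coproduct k gT V).

(** The component of degree (n, 1) of the coproduct, read on the letter b. *)
Definition pder (b : B) (x : TV) : TV := contract (fmu b) (coproduct x).
HB.instance Definition _ b :=
  GRing.isLinear.Build k TV TV *:%R (pder b)
    (fun a x y => etrans (congr1 (contract (fmu b)) (linearP (@coproduct k gT V) a x y))
      (linearP (contract (fmu b)) a _ _)).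

Lemma braided_mul_linear z : linear (@braided_mul k gT V z).
Proof.
move=> a x y; rewrite scaler_sumr -big_split /=; apply: eq_bigr => p _.
by rewrite (linearP (mext _)) scalerDr !scalerA mulrC.
Qed.
HB.instance Definition _ z :=
  GRing.isLinear.Build k TTV TTV *:%R (@braided_mul k gT V z) (braided_mul_linear z).

Lemma word_deg1 : word_deg (mone : word) = 1%g.
Proof. by rewrite /word_deg fm1 big_nil. Qed.
Lemma word_degU i : word_deg (fmu i : word) = yd_deg i.
Proof. by rewrite /word_deg fmU big_seq1. Qed.

Definition lmul (a x : TV) : TV := a * x.
Lemma lmul_linear a : linear (lmul a).
Proof. by move=> c x y; rewrite /lmul mulrDr -malg_scaleAr. Qed.
HB.instance Definition _ a :=
  GRing.isLinear.Build k TV TV *:%R (lmul a) (lmul_linear a).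

Lemma braided_mulU (p q : word * word) : braided_mul (tpair p) (tpair q) =
  mtensor (tword p.1 * word_act (word_deg p.2) q.1) (tword p.2 * tword q.2).
Proof. by rewrite /braided_mul !mext_tpair. Qed.

Definition letterl i : TTV := tpair (fmu i, mone).
Definition letterr i : TTV := tpair (mone, fmu i).

Lemma letterlE i : letterl i = mtensor (tword (fmu i)) (1 : TV).
Proof. by rewrite -tword1 mtensor_tword. Qed.

Lemma letterrE i : letterr i = mtensor (1 : TV) (tword (fmu i)).
Proof. by rewrite -tword1 mtensor_tword. Qed.

Lemma contract_braidedl v i z :
  contract v (braided_mul (letterl i) z) =
  tword (fmu i) * contract v z.
Proof.
apply: (tensor2_ext (f := contract v \o @braided_mul _ _ V _)
  (g := lmul (tword (fmu i)) \o contract v)) => -[q1 q2] /=.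
rewrite /letterl braided_mulU /= word_deg1 word_act_id !twordM mul1m contract_mtensor.
by rewrite /lmul -mtensor_tword contract_mtensor -malg_scaleAr twordM.
Qed.

(** The term 1 (x) i of the coproduct of a letter contributes to the slice at i
    only through the terms a (x) 1 of the other factor; the braiding moves a past
    i and lets the degree of i act on it. *)
Lemma contract_braidedr i z :
  contract (fmu i) (braided_mul (letterr i) z) =
  tact (yd_deg i) (contract mone z).
Proof.
apply: (tensor2_ext (f := contract (fmu i) \o @braided_mul _ _ V _)
  (g := tact (yd_deg i) \o contract mone)) => -[q1 q2] /=.
rewrite /letterr braided_mulU /= word_degU twordM contract_mtensor.
rewrite -mtensor_tword contract_mtensor !mcoeff_tword mul1r.
have -> : (mmul (fmu i) q2 == fmu i) = (q2 == mone).
  by rewrite !fmP fmM fmU fm1 /= eqseq_cons eqxx.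
by rewrite tactZ tactU.
Qed.

Lemma contract_braided0 v i z : (forall q : word, mmul (fmu i) q != v) ->
  contract v (braided_mul (letterr i) z) = 0.
Proof.
move=> hv; apply: (tensor2_ext (f := contract v \o @braided_mul _ _ V _)
  (g := \0)) => -[q1 q2] /=.
rewrite /letterr braided_mulU /= twordM contract_mtensor.
by rewrite mcoeff_tword (negPf (hv _)) scale0r.
Qed.

Lemma coproductU i (w : word) :
  coproduct (tword (mmul (fmu i) w)) =
  braided_mul (letterl i) (coproduct (tword w)) +
  braided_mul (letterr i) (coproduct (tword w)).
Proof.
rewrite letterlE letterrE /coproduct !mext_tword fmM fmU /=.
exact: (linearD (mext _)).
Qed.

Lemma coproduct1 : coproduct (1 : TV) = tpair (mone, mone).
Proof. by rewrite -tword1 /coproduct mext_tword fm1 /= -mtensor_tword. Qed.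

#[local] Opaque letterl letterr braided_mul contract coproduct.

Lemma contract_coproduct x : contract mone (coproduct x) = x.
Proof.
apply: (tensor_ext (f := contract mone \o @coproduct _ _ V) (g := idfun)) => w /=.
elim/word_ind: w => [|i w IH].
  by rewrite tword1 coproduct1 contractU eqxx.
rewrite coproductU contractD [X in X + _]contract_braidedl IH twordM.
rewrite contract_braided0 ?addr0 //.
by move=> q; rewrite fmM_eq1 fm1_eq1.
Qed.

Lemma pder1 b : pder b 1 = 0.
Proof.
by rewrite /pder coproduct1 contractU eq_sym fm1_eq1.
Qed.

Lemma pder_cons b i (w : word) : pder b (tword (mmul (fmu i) w)) =
  tword (fmu i) * pder b (tword w) + (b == i)%:R *: tact (yd_deg b) (tword w).
Proof.
rewrite /pder coproductU contractD [X in X + _]contract_braidedl; congr (_ + _).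
case: eqP => [->|/eqP bi].
  by rewrite contract_braidedr contract_coproduct scale1r.
rewrite scale0r contract_braided0 // => q.
by rewrite fmP fmM !fmU eqseq_cons eq_sym (negPf bi).
Qed.

Lemma pderP b : linear (pder b). Proof. exact: linearP. Qed.

(** The Leibniz rule follows from the recursion over the first letter, since the
    group acts by algebra automorphisms. *)
Lemma pderM b (x y : TV) :
  pder b (x * y) = x * pder b y + pder b x * tact (yd_deg b) y.
Proof.
move: x y; apply: (malg_bilinear_eq (f := fun x y => pder b (x * y))
  (g := fun x y => x * pder b y + pder b x * tact (yd_deg b) y)).
- by move=> x c y z; rewrite mulrDr -malg_scaleAr pderP.
- by move=> x c y z; rewrite mulrDl -scalerAl pderP.
- by move=> x c y z; rewrite !(pderP, tactP) !mulrDr -!malg_scaleAr scalerDr addrACA.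
- by move=> x c y z; rewrite !(pderP, tactP) !mulrDl -!scalerAl scalerDr addrACA.
elim/word_ind=> [v|i w IH v].
  by rewrite twordM mul1m tword1 pder1 mul0r addr0 mul1r.
rewrite twordM -mulmA pder_cons -twordM IH.
rewrite tactM.
rewrite pder_cons -twordM.
exact: leibniz_step.
Qed.

Local Notation N := (@nichols_ideal k gT V).

(** The words of size at least 2 span an ideal, which contains the generators of
    the Nichols ideal. *)
Lemma nichols_ideal_size x w : N x -> w \in msupp x -> (2 <= size w)%N.
Proof.
move=> Nx; move: w; have [_ [X [homX genX]] _] := nichols_ideal_max V.
have small (y : TV) : (forall w : word, w \in msupp y -> (2 <= size w)%N) <->
    forall w : word, (size w < 2)%N -> y@_w = 0.
  split=> hy w; last first.
    by rewrite -mcoeff_neq0 ltnNge; apply: contra => /hy/eqP.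
  by rewrite ltnNge => hw; apply: mcoeff_outdom; apply: contra hw; apply: hy.
pose I2 (y : TV) := forall w : word, w \in msupp y -> (2 <= size w)%N.
move/genX: Nx => /(_ I2); apply.
  split.
  - split=> [w|c u v Hu Hv]; first by rewrite msupp0 inE.
    move/small in Hu; move/small in Hv; apply/small => w hw.
    by rewrite mcoeffD mcoeffZ Hu // Hv // mulr0 addr0.
  - move=> a y Hy w /msuppM_le[u [v [ua vy ->]]].
    by rewrite fmM size_cat (leq_trans (Hy _ vy)) ?leq_addl.
  move=> a y Hy w /msuppM_le[u [v [uy va ->]]].
  by rewrite fmM size_cat (leq_trans (Hy _ uy)) ?leq_addr.
by move=> y /homX[n n2 hy] w /hy ->.
Qed.

(** The coproduct of x in N is a sum of tensors a (x) b with a or b in N; when b is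
    in N its coefficient on a single letter vanishes. *)
Lemma nichols_ideal_pder b x : N x -> N (pder b x).
Proof.
move=> Nx; have [ghi _ _] := nichols_ideal_max V.
have [sN _ _] := ghi_ideal ghi.
apply: (span_linear (f := contract (fmu b)) sN) (ghi_coproduct ghi Nx).
move=> _ [u [v [uv ->]]] /=; rewrite contract_mtensor.
have [N0 NL] := sN.
case: uv => [Nu|Nv]; first by rewrite -[_ *: _]addr0; apply: NL.
suff -> : v@_(fmu b) = 0 by rewrite scale0r.
apply: mcoeff_outdom; apply/negP=> /(nichols_ideal_size Nv).
by rewrite fmU.
Qed.

Lemma nichols_ideal_not1 : ~ N 1.
Proof.
move=> N1; have := nichols_ideal_size (w := mone) N1.
by rewrite -mcoeff_neq0 mcoeff1 eqxx oner_eq0 fm1 => /(_ isT).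
Qed.

Lemma pder_tgen b u : pder b (tgen u) = u@_b *: 1.
Proof.
rewrite -(mext_delta b) -/(tgen u).
apply: (linear_basis_eq (f := pder b \o @tgen _ _ V) (g := mext _)) => i /=.
rewrite tgenU [RHS]mextU -[fmu i]mulm1 pder_cons tword1 pder1 mulr0 add0r tact_one.
by rewrite eq_sym; case: eqP; rewrite ?scale1r ?scale0r.
Qed.

End TensorAlgebra.

(** * Algebras with skew derivations *)

(** What the argument uses of T(V) and its Nichols ideal: a G-algebra generated by
    V with the skew derivations dual to the basis of V, and a proper subspace
    stable under them.  Working over this interface keeps words out of sight. *)
Record braidedAlgebra (k : fieldType) (gT : finGroupType) (V : ydModule k gT) :=
  BraidedAlgebra {
  ba_sort :> lalgType k;
  ba_scaleAr : forall (c : k) (a b : ba_sort), c *: (a * b) = a * (c *: b);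
  ba_act : gT -> {linear ba_sort -> ba_sort};
  ba_act1 : forall a, ba_act 1%g a = a;
  ba_actC : forall g h a, ba_act (g * h)%g a = ba_act g (ba_act h a);
  ba_actM : forall g a b, ba_act g (a * b) = ba_act g a * ba_act g b;
  ba_act_one : forall g, ba_act g 1 = 1;
  ba_der : yd_base V -> {linear ba_sort -> ba_sort};
  ba_derM : forall b x y,
    ba_der b (x * y) = x * ba_der b y + ba_der b x * ba_act (yd_deg b) y;
  ba_gen : {linear {malg k[yd_base V]} -> ba_sort};
  ba_act_gen : forall g u, ba_act g (ba_gen u) = ba_gen (mext (@yd_act _ _ V g) u);
  ba_der_gen : forall b u, ba_der b (ba_gen u) = u@_b *: 1;
  ba_ideal : ba_sort -> Prop;
  ba_ideal_subspace : subspace ba_ideal;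
  ba_ideal_der : forall b x, ba_ideal x -> ba_ideal (ba_der b x);
  ba_ideal_proper : ~ ba_ideal 1
}.

Definition tensorBraided (k : fieldType) (gT : finGroupType) (V : ydModule k gT) :
  braidedAlgebra V :=
  @BraidedAlgebra k gT V _ (@malg_scaleAr _ _) (@tact k gT V) (@tact1 _ _ _)
   (@tact_comp _ _ _) (@tactM _ _ _) (@tact_one _ _ _) (@pder k gT V) (@pderM _ _ _)
   (@tgen k gT V) (@tact_tgen _ _ _) (@pder_tgen _ _ _) (@nichols_ideal k gT V)
   (let: And3 s _ _ := nichols_ideal_ideal V in s)
   (@nichols_ideal_pder _ _ _) (@nichols_ideal_not1 _ _ _).

Section Criteria.
Context (k : fieldType) (gT : finGroupType) (V : ydModule k gT).
Context (A : braidedAlgebra V).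
Context (char0 : [pchar k] =i pred0).

Local Notation act := (ba_act A).
Local Notation N := (@ba_ideal _ _ _ A).
Local Notation gen := (ba_gen A).
Local Notation B := (yd_base V).

Lemma ideal0 : N 0. Proof. by case: (ba_ideal_subspace A). Qed.
Lemma idealD x y : N x -> N y -> N (x + y).
Proof.
by case: (ba_ideal_subspace A) => _ NL Nx Ny; rewrite -[x]scale1r; apply: NL.
Qed.
Lemma idealZ c x : N x -> N (c *: x).
Proof.
by case: (ba_ideal_subspace A) => N0 NL Nx; rewrite -[_ *: _]addr0; apply: NL.
Qed.
Lemma ideal_sum I (r : seq I) (F : I -> A) :
  (forall i, N (F i)) -> N (\sum_(i <- r) F i).
Proof. by move=> NF; elim/big_rec: _ => [|i x _]; [apply: ideal0 | apply: idealD]. Qed.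

Lemma span_ideal_coef (s : seq A) w :
  span (fun v => v \in s \/ N v) w ->
  exists c : 'I_(size s) -> k, N (w - \sum_j c j *: s`_j).
Proof.
move=> /(_ (fun w => exists c : 'I_(size s) -> k, N (w - \sum_j c j *: s`_j))); apply.
  split=> [|a u v [c Nc] [d Nd]].
    exists (fun=> 0); rewrite big1 ?subrr; first exact: ideal0.
    by move=> j _; rewrite scale0r.
  exists (fun j => a * c j + d j).
  have -> : a *: u + v - \sum_j (a * c j + d j) *: s`_j
          = a *: (u - \sum_j c j *: s`_j) + (v - \sum_j d j *: s`_j).
    rewrite scalerBr addrACA -opprD; congr (_ - _).
    rewrite scaler_sumr -big_split /=; apply: eq_bigr => j _.
    by rewrite scalerDl scalerA.
  by apply: idealD => //; apply: idealZ.
move=> v [sv|Nv].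
  have ltv : (index v s < size s)%N by rewrite index_mem.
  exists (fun j => (j == Ordinal ltv)%:R).
  rewrite (bigD1 (Ordinal ltv)) //= eqxx scale1r big1 ?addr0 => [|j /negPf->].
    by rewrite nth_index // subrr; apply: ideal0.
  by rewrite scale0r.
exists (fun=> 0); rewrite big1 ?subr0 // => j _; exact: scale0r.
Qed.

(** The powers of z are independent modulo the ideal: E turns a relation between
    z^0, .., z^n into one between z^0, .., z^(n-1), and in characteristic 0 the
    factors m c do not vanish.  So no finite set spans the quotient. *)
Lemma lowering_infinite (E : {linear A -> A}) (z : A) (c : k) :
  (forall x, N x -> N (E x)) -> c != 0 ->
  (forall m, E (z ^+ m) = (m%:R * c) *: z ^+ m.-1) ->
  ~ finite_dim_quotient N.
Proof.
move=> NE c0 Ez [s ss].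
have free n : forall v : nat -> k,
    N (\sum_(i < n) v i *: z ^+ i) -> forall i, (i < n)%N -> v i = 0.
  elim: n => [//|n IH] v Nv.
  have v1 i : (i < n)%N -> v i.+1 = 0.
    move=> lt_in; have /NE := Nv; rewrite big_ord_recl linearD linearZ /= Ez.
    rewrite mul0r scale0r scaler0 add0r linear_sum /= => Nv'.
    have /(_ (fun i => v i.+1 * (i.+1%:R * c))) := IH.
    move=> /(_ _ i lt_in) /eqP; rewrite !mulf_eq0 (negPf c0) orbF.
    rewrite ((pcharf0P _).1 char0) orbF => H; apply/eqP/H.
    under eq_bigr => j _ do rewrite -scalerA -[i in z ^+ i]/(j.+1.-1) -Ez -linearZ.
    exact: Nv'.
  case=> [_|i]; last exact: v1.
  move: Nv; rewrite big_ord_recl big1 ?addr0 => [|i _]; last first.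
    by rewrite v1 // scale0r.
  move=> /(idealZ (v 0%N)^-1); rewrite scalerA; case: (eqVneq (v 0%N) 0) => // v0.
  by rewrite mulVf // scale1r => /(@ba_ideal_proper _ _ _ A).
pose n := size s.
have [c' Hc'] := @fin_all_exists _ _ (fun (i : 'I_n.+1) (c : 'I_n -> k) =>
  N (z ^+ i - \sum_j c j *: s`_j)) (fun i => span_ideal_coef (ss (z ^+ i))).
pose M := \matrix_(i < n.+1, j < n) c' i j.
have : kermx M != 0.
  rewrite kermx_eq0 -row_leq_rank -ltnNge ltnS; exact: rank_leq_col.
case/rowV0Pn=> v /sub_kermxP vM /rV0Pn[i vi].
case/eqP: vi; have := free n.+1 (fun i => v 0 (inord i)) _ i (ltn_ord i).
rewrite inord_val; apply; under eq_bigr => j _ do rewrite inord_val.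
have -> : \sum_(j < n.+1) v 0 j *: z ^+ j =
   \sum_(j < n.+1) v 0 j *: (z ^+ j - \sum_l c' j l *: s`_l).
  apply/eqP; rewrite -subr_eq0 -sumrB.
  under eq_bigr => j _ do rewrite -scalerBr opprB addrC subrK.
  under eq_bigr => j _ do rewrite scaler_sumr.
  rewrite exchange_big big1 // => l _ /=.
  under eq_bigr => j _ do rewrite scalerA.
  rewrite -scaler_suml; have /matrixP/(_ 0 l) := vM.
  rewrite !mxE => e; rewrite (_ : \sum_(j < n.+1) _ = 0) ?scale0r // -[RHS]e.
  by apply: eq_bigr => j _; rewrite mxE.
by apply: ideal_sum => j; apply: idealZ.
Qed.

Definition homog_functional (g : gT) (F : B -> k) :=
  forall b, F b != 0 -> yd_deg b = g.

(** The derivation along a functional F on V.  It has a Leibniz rule only when F is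
    supported in a single degree, hence [homog_functional]. *)
Definition fder (F : B -> k) (z : A) : A := \sum_b F b *: ba_der A b z.

Fact fder_linear F : linear (fder F).
Proof.
move=> c x y; rewrite /fder scaler_sumr -big_split; apply: eq_bigr => b _ /=.
by rewrite linearP scalerDr !scalerA mulrC.
Qed.
HB.instance Definition _ F :=
  GRing.isLinear.Build k A A *:%R (fder F) (fder_linear F).

Lemma fder_ideal F x : N x -> N (fder F x).
Proof. by move=> Nx; apply: ideal_sum => b; apply/idealZ/ba_ideal_der. Qed.

Lemma fderM g F x y : homog_functional g F ->
  fder F (x * y) = x * fder F y + fder F x * act g y.
Proof.
move=> hF; rewrite /fder mulr_sumr mulr_suml -big_split; apply: eq_bigr => b _ /=.
rewrite ba_derM scalerDr; congr (_ + _); first exact: ba_scaleAr.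
case: (eqVneq (F b) 0) => [->|/hF->]; first by rewrite !scale0r mul0r.
exact: scalerAl.
Qed.

Definition pairing (F : B -> k) (u : {malg k[B]}) : k := \sum_b F b * u@_b.

Lemma fder_gen F u : fder F (gen u) = pairing F u *: 1.
Proof.
rewrite /fder /pairing scaler_suml; apply: eq_bigr => b _.
by rewrite ba_der_gen scalerA.
Qed.

Section Coinvariants.
Variable P : pred B.

(** Killing the translates act h z too makes this subalgebra stable under the group
    by definition, with no formula for the conjugate of a derivation. *)
Definition coinv (z : A) : Prop := forall h b, P b -> ba_der A b (act h z) = 0.

Lemma coinvD x y : coinv x -> coinv y -> coinv (x + y).
Proof. by move=> cx cy h b Pb; rewrite !linearD /= cx // cy // addr0. Qed.

Lemma coinvZ c x : coinv x -> coinv (c *: x).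
Proof. by move=> cx h b Pb; rewrite !linearZ /= cx // scaler0. Qed.

Lemma coinvN x : coinv x -> coinv (- x).
Proof. by rewrite -scaleN1r; apply: coinvZ. Qed.

Lemma coinv_der z b : coinv z -> P b -> ba_der A b z = 0.
Proof. by move=> cz Pb; rewrite -[z]ba_act1 cz. Qed.

Lemma coinv_act h z : coinv z -> coinv (act h z).
Proof. by move=> cz g b Pb; rewrite -ba_actC cz. Qed.

Lemma coinvM x y : coinv x -> coinv y -> coinv (x * y).
Proof.
by move=> cx cy h b Pb; rewrite ba_actM ba_derM cy // cx // mulr0 mul0r addr0.
Qed.

Lemma coinv1 : coinv 1.
Proof.
move=> h b _; rewrite ba_act_one; apply: (addrI (ba_der A b 1)).
by rewrite addr0 -[in RHS](mulr1 1) ba_derM mul1r ba_act_one mulr1.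
Qed.

Lemma coinvX x n : coinv x -> coinv (x ^+ n).
Proof.
move=> cx; elim: n => [|n IH]; first exact: coinv1.
by rewrite exprS; apply: coinvM.
Qed.

Lemma coinv_fder F z : coinv z -> (forall b, F b != 0 -> P b) -> fder F z = 0.
Proof.
move=> cz FP; rewrite /fder big1 // => b _.
case: (eqVneq (F b) 0) => [->|/FP Pb]; first exact: scale0r.
by rewrite (coinv_der cz Pb) scaler0.
Qed.

End Coinvariants.

Definition skew_on (K : A -> Prop) (g : gT) (D : A -> A) :=
  forall a b, K a -> K b -> D (a * b) = a * D b + D a * act g b.

Lemma fder_skew K g F : homog_functional g F -> skew_on K g (fder F).
Proof. by move=> hF a b _ _; apply: fderM. Qed.

(** In general a composite of skew derivations is not one.  On coinvariants the two
    cross terms contain a derivation along P of a coinvariant element, and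
    vanish. *)
Lemma skew_comp (P : pred B) g h F (D : {linear A -> A}) :
  homog_functional g F -> (forall b, F b != 0 -> P b) ->
  skew_on (coinv P) h D -> skew_on (coinv P) (g * h)%g (fder F \o D).
Proof.
move=> hF FP hD a b ca cb /=; rewrite hD // linearD /= !(fderM _ _ hF).
rewrite (coinv_fder ca FP) mul0r addr0 -ba_actC.
by rewrite (coinv_fder (coinv_act h cb) FP) mulr0 add0r.
Qed.

(** The braided commutator of an element a of degree g with r. *)
Definition bracket (g : gT) (a r : A) : A := a * r - act g r * a.

Definition supported (P : pred B) (u : {malg k[B]}) := forall b, u@_b != 0 -> P b.
Definition homog (g : gT) (u : {malg k[B]}) := forall b, u@_b != 0 -> yd_deg b = g.
Definition stable (P : pred B) :=
  forall h b c, P b -> c \in msupp (@yd_act _ _ V h b) -> P c.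

Lemma act_supp h (u : {malg k[B]}) c : (mext (@yd_act _ _ V h) u)@_c != 0 ->
  exists2 b, u@_b != 0 & c \in msupp (yd_act h b).
Proof.
by rewrite mcoeff_neq0 => /msupp_mext[b bu cb]; exists b; rewrite ?mcoeff_neq0.
Qed.

Lemma stable_act P h u : stable P -> supported P u ->
  supported P (mext (@yd_act _ _ V h) u).
Proof. by move=> sP su c /act_supp[b /su Pb]; apply: sP. Qed.

Lemma homog_act g h u : homog g u ->
  homog (h * g * h^-1)%g (mext (@yd_act _ _ V h) u).
Proof. by move=> hu c /act_supp[b /hu <-]; apply: yd_act_deg. Qed.

Lemma coinv_gen (P Q : pred B) u : stable Q -> supported Q u ->
  (forall b, P b -> ~~ Q b) -> coinv P (gen u).
Proof.
move=> sQ su PQ h b /PQ nQ; rewrite ba_act_gen ba_der_gen.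
have /contraNeq/(_ nQ)-> := @stable_act _ h _ sQ su b.
exact: scale0r.
Qed.

(** A derivation along P kills both occurrences of r, and takes the same scalar
    value on both occurrences of u; the two remaining terms cancel because the
    letters of u have degree g.  A translate of the bracket is again a bracket, for
    the conjugate degree. *)
Lemma coinv_bracket P g u r : stable P -> supported P u -> homog g u ->
  coinv P r -> coinv P (bracket g (gen u) r).
Proof.
move=> sP su hu cr h b Pb; rewrite /bracket linearB /= !ba_actM ba_act_gen -ba_actC.
have -> : (h * g = (h * g * h^-1) * h)%g by rewrite mulgKV.
rewrite (ba_actC _ h); have := @homog_act g h u hu; have := @stable_act P h u sP su.
move: (mext _ u) (h * g * h^-1)%g (coinv_act h cr) => {u g su hu} u g {}cr su hu.
rewrite linearB /= !ba_derM !ba_der_gen (coinv_der cr Pb) cr // mulr0 mul0r add0r addr0.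
case: (eqVneq u@_b 0) => [->|/hu->]; first by rewrite !scale0r mul0r mulr0 subrr.
by rewrite -scalerAl -ba_scaleAr mul1r mulr1 subrr.
Qed.

(** * Two criteria for infinite dimension *)
Lemma skew_one P g D : skew_on (coinv P) g D -> D 1 = 0.
Proof.
move=> sD; apply: (addrI (D 1)); rewrite addr0 -[in RHS](mulr1 1).
by rewrite (sD _ _ (@coinv1 P) (@coinv1 P)) mul1r ba_act_one mulr1.
Qed.

Lemma act_exp g x m : act g (x ^+ m) = act g x ^+ m.
Proof.
by elim: m => [|m IH]; rewrite ?expr0 ?ba_act_one // !exprS ba_actM IH.
Qed.

Lemma exprZ_ba c (x : A) m : (c *: x) ^+ m = c ^+ m *: x ^+ m.
Proof.
elim: m => [|m IH]; first by rewrite !expr0 scale1r.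
by rewrite !exprS IH -scalerAl -ba_scaleAr scalerA.
Qed.

(** A root vector with self-braiding 1 generates a polynomial algebra: by the skew
    Leibniz rule D(z^m) = m c z^(m-1). *)
Lemma power_infinite P g (D : {linear A -> A}) z c :
  (forall x, N x -> N (D x)) -> skew_on (coinv P) g D ->
  coinv P z -> act g z = z -> D z = c *: 1 -> c != 0 ->
  ~ finite_dim_quotient N.
Proof.
move=> ND sD cz gz Dz c0; apply: (lowering_infinite ND c0 (z := z)).
elim=> [|m IH]; first by rewrite (skew_one sD) mul0r scale0r.
rewrite exprS (sD _ _ cz (coinvX m cz)) IH act_exp gz Dz -scalerAl mul1r -ba_scaleAr /=.
rewrite -[m.+1%:R]natr1 [in RHS]mulrDl mul1r scalerDl; congr (_ + _).
by case: m {IH} => [|m]; rewrite ?mul0r ?scale0r // -exprS.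
Qed.

(** With z = n p - lam p n one finds Dp z = cp (1 - lam / nu) n and Dn z = 0, so
    Dn Dp acts on the powers of z as a multiple of the ordinary derivative.  The
    scalars by which g rescales z cancel, since the degrees of n and p are
    inverse. *)
Lemma pair_infinite P g (Dn Dp : {linear A -> A}) n p lam nu cn cp :
  (forall x, N x -> N (Dn x)) -> (forall x, N x -> N (Dp x)) ->
  skew_on (coinv P) g Dn -> skew_on (coinv P) g^-1%g Dp ->
  coinv P n -> coinv P p ->
  act g n = nu *: n -> act g p = lam *: p -> nu != 0 -> lam != 0 -> nu != lam ->
  Dn n = cn *: 1 -> Dp p = cp *: 1 -> Dn p = 0 -> Dp n = 0 -> cn != 0 -> cp != 0 ->
  ~ finite_dim_quotient N.
Proof.
move=> NDn NDp sn sp Kn Kp gn gp nu0 lam0 nulam Dnn Dpp Dnp Dpn cn0 cp0.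
have inv x a : a != 0 -> act g x = a *: x -> act g^-1%g x = a^-1 *: x.
  move=> a0 gx; rewrite -{1}[x](scalerK a0) -gx linearZ /= -ba_actC mulVg.
  by rewrite ba_act1.
pose z := n * p - lam *: (p * n).
have Kz : coinv P z by apply/coinvD/coinvN/coinvZ/coinvM => //; apply: coinvM.
have gz : act g z = (nu * lam) *: z.
  rewrite /z linearB linearZ /= !ba_actM gn gp -!scalerAl -!ba_scaleAr.
  rewrite scalerBr !scalerA.
  by congr (_ - _ *: _); ring.
have Dnz : Dn z = 0.
  rewrite /z linearB linearZ /= !sn // Dnn Dnp gp mulr0 add0r mul0r addr0.
  by rewrite -scalerAl mul1r -ba_scaleAr mulr1 scalerA mulrC -scalerA subrr.
have Dpz : Dp z = (cp * (1 - lam / nu)) *: n.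
  rewrite /z linearB linearZ /= !sp // Dpp Dpn mulr0 add0r mul0r addr0.
  rewrite -scalerAl mul1r (inv _ _ nu0 gn) -ba_scaleAr mulr1 !scalerA -scalerBl.
  by congr (_ *: _); ring.
have Dnzm m : Dn (z ^+ m) = 0.
  elim: m => [|m IH]; first exact: skew_one sn.
  by rewrite exprS (sn _ _ Kz (coinvX m Kz)) IH Dnz mulr0 mul0r addr0.
have KDp m : coinv P (Dp (z ^+ m)).
  elim: m => [|m IH].
    by rewrite (skew_one sp) -[0](scale0r 1); apply/coinvZ/coinv1.
  rewrite exprS (sp _ _ Kz (coinvX m Kz)) Dpz; apply: coinvD; first exact: coinvM.
  by apply: coinvM; [apply: coinvZ | apply/coinv_act/coinvX].
pose c := cp * (1 - lam / nu) * cn.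
have c0 : c != 0.
  rewrite !mulf_neq0 // subr_eq0; apply: contra nulam => /eqP e.
  by rewrite -[nu]mul1r e divfK.
have NE x : N x -> N ((Dn \o Dp) x) by move=> /NDp/NDn.
apply: (lowering_infinite NE c0 (z := z)).
elim=> [|m IH] /=; first by rewrite (skew_one sp) mul0r scale0r linear0.
rewrite exprS (sp _ _ Kz (coinvX m Kz)) linearD /= (sn _ _ Kz (KDp m)).
rewrite [Dn (Dp _)]IH Dnz mul0r addr0.
rewrite Dpz -scalerAl linearZ /= (sn _ _ Kn (coinv_act _ (coinvX m Kz))).
have zl : nu * lam != 0 by rewrite mulf_neq0.
rewrite act_exp (inv _ _ zl gz) exprZ_ba linearZ /= Dnzm scaler0 mulr0 add0r.
rewrite linearZ /= act_exp gz exprZ_ba scalerA -exprMn mulVf // expr1n scale1r.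
rewrite Dnn -scalerAl mul1r scalerA -/c -ba_scaleAr /=.
rewrite -[m.+1%:R]natr1 [in RHS]mulrDl mul1r scalerDl; congr (_ + _).
by case: m {IH} => [|m]; rewrite ?mul0r ?scale0r // -exprS.
Qed.

End Criteria.

(** * Blocks and their tables *)
Section Blocks.
Context (k : fieldType) (gT : finGroupType) (V : ydModule k gT).
Local Notation U := {malg k[yd_base V]}.

Definition mact (h : gT) : U -> U := mext (@yd_act _ _ V h).
HB.instance Definition _ h := GRing.Linear.on (mact h).

(** A two-dimensional summand of V: homogeneous u0, u1 in the span of a stable set P
    of basis vectors, with dual functionals F0, F1 supported in the same degrees, so
    that the derivations along F0 and F1 are skew. *)
Record block (P : pred (yd_base V)) (g0 g1 : gT) (u0 u1 : U)
    (F0 F1 : yd_base V -> k) : Prop := Block {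
  block_stable : stable P;
  block_sup0 : supported P u0;
  block_sup1 : supported P u1;
  block_hom0 : homog g0 u0;
  block_hom1 : homog g1 u1;
  block_supF0 : forall b, F0 b != 0 -> P b;
  block_supF1 : forall b, F1 b != 0 -> P b;
  block_homF0 : homog_functional g0 F0;
  block_homF1 : homog_functional g1 F1;
  block_00 : pairing F0 u0 = 1;
  block_01 : pairing F0 u1 = 0;
  block_10 : pairing F1 u0 = 0;
  block_11 : pairing F1 u1 = 1
}.

(** The table of M(O_{x^2}, rho), rho irreducible of dimension 2. *)
Definition central_table (x y : gT) (u0 u1 : U) : Prop :=
  [/\ mact x u0 = u1, mact x u1 = - u0, mact y u0 = u0 & mact y u1 = - u1].

(** The table of M(O_x, chi) when chi(x) = -1. *)
Definition rotation_table (x y : gT) (u0 u1 : U) : Prop :=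
  [/\ mact x u0 = - u0, mact x u1 = - u1, mact y u0 = u1 & mact y u1 = u0].

(** The table of M(O_y, chi) when chi(y) = -1 and chi(x^2) = e. *)
Definition reflection_table (x y : gT) (e : k) (u0 u1 : U) : Prop :=
  [/\ mact x u0 = u1, mact x u1 = e *: u0, mact y u0 = - u0 & mact y u1 = - (e *: u1)].

End Blocks.

Section DihedralWords.
Context (gT : finGroupType) (x y : gT) (hy : (y ^+ 2 = 1)%g) (hx : (x ^+ 4 = 1)%g)
  (hyxy : (y * x * y = x^-1)%g).

(** Rewrite rules that bring every word in x and y to the form x^i y^j. *)
Lemma dihedral_normal :
  ((y * y = 1)%g * (forall z, y * (y * z) = z)%g) *
  ((y * x = x * (x * (x * y)))%g *
   (forall z, y * (x * z) = x * (x * (x * (y * z))))%g) *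
  ((x * (x * (x * x)) = 1)%g * (forall z, x * (x * (x * (x * z))) = z)%g) *
  ((x^-1 = x * (x * x))%g * (y^-1 = y)%g).
Proof.
have yy : (y * y = 1)%g by [].
have x4 : (x * (x * (x * x)) = 1)%g by [].
have xV : (x^-1 = x * (x * x))%g by rewrite -[LHS]mul1g -x4 !mulgA mulgK.
have yx : (y * x = x * (x * (x * y)))%g.
  by apply: (mulIg y); rewrite hyxy -!mulgA yy mulg1 xV.
have yyz z : (y * (y * z) = z)%g by rewrite mulgA yy mul1g.
have yxz z : (y * (x * z) = x * (x * (x * (y * z))))%g by rewrite mulgA yx -!mulgA.
have x4z z : (x * (x * (x * (x * z))) = z)%g.
  by rewrite -[RHS]mul1g -x4 -!mulgA.
have yV : (y^-1 = y)%g by apply/eqP; rewrite eq_invg_mul yy.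
by do !split.
Qed.

End DihedralWords.

Ltac dihedral hy hx hyxy :=
  let E := constr:(dihedral_normal hy hx hyxy) in
  rewrite ?invgK ?invMg ?expgSr ?expg1 ?expg0 ?mul1g -?mulgA ?E
    -?mulgA ?E -?mulgA ?E ?mulg1 -?mulgA ?E ?mulg1.

(** * Pairs and triples of blocks *)
Section Triples.
Context (k : fieldType) (gT : finGroupType) (V : ydModule k gT).
Context (A : braidedAlgebra V).
Context (char0 : [pchar k] =i pred0).
Context (x y : gT) (hy : (y ^+ 2 = 1)%g) (hx : (x ^+ 4 = 1)%g)
  (hyxy : (y * x * y = x^-1)%g).

Local Notation act := (ba_act A).
Local Notation N := (@ba_ideal _ _ _ A).
Local Notation gen := (ba_gen A).
Local Notation fder := (fder (A := A)).

Lemma act_gen h u : act h (gen u) = gen (mact h u).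
Proof. exact: ba_act_gen. Qed.

Lemma fder_block (P : pred (yd_base V)) g0 g1 u0 u1 F0 F1 :
  block P g0 g1 u0 u1 F0 F1 ->
  [/\ fder F0 (gen u0) = 1, fder F0 (gen u1) = 0,
      fder F1 (gen u0) = 0 & fder F1 (gen u1) = 1].
Proof.
move=> b; rewrite !fder_gen (block_00 b) (block_01 b) (block_10 b) (block_11 b).
by rewrite !scale1r !scale0r.
Qed.

Lemma fder_disjoint (P Q : pred (yd_base V)) F u :
  (forall b, F b != 0 -> P b) -> supported Q u -> (forall b, P b -> ~~ Q b) ->
  fder F (gen u) = 0.
Proof.
move=> FP uQ PQ; rewrite fder_gen /pairing big1 ?scale0r // => b _.
case: (eqVneq (F b) 0) => [->|/FP/PQ]; first exact: mul0r.
by case: (eqVneq u@_b 0) => [-> _|/uQ ->]; rewrite ?mulr0.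
Qed.

Lemma coinv_disjoint (P Q : pred (yd_base V)) g0 g1 u0 u1 F0 F1 :
  block Q g0 g1 u0 u1 F0 F1 -> (forall b, P b -> ~~ Q b) ->
  coinv P (gen u0) /\ coinv P (gen u1).
Proof.
by move=> b PQ; split; apply: coinv_gen (block_stable b) _ PQ;
  [apply: block_sup0 b | apply: block_sup1 b].
Qed.

Definition disj (P Q : pred (yd_base V)) := forall b, P b -> ~~ Q b.

Lemma disjC P Q : disj P Q -> disj Q P.
Proof. by move=> PQ b Qb; apply/negP => /PQ; rewrite Qb. Qed.

Lemma disjU P Q R : disj P R -> disj Q R -> disj (predU P Q) R.
Proof. by move=> PR QR b /orP[/PR|/QR]. Qed.

Lemma stableU (P Q : pred (yd_base V)) : stable P -> stable Q -> stable (predU P Q).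
Proof.
move=> sP sQ h b c /orP[Pb|Qb] cb; apply/orP.
  by left; apply: sP cb.
by right; apply: sQ cb.
Qed.

Lemma supportedS (P Q : pred (yd_base V)) u :
  subpred P Q -> supported P u -> supported Q u.
Proof. by move=> PQ su b /su/PQ. Qed.

Lemma ideal_comp (D E : A -> A) :
  (forall x, N x -> N (D x)) -> (forall x, N x -> N (E x)) ->
  forall x, N x -> N ((D \o E) x).
Proof. by move=> ND NE z /NE/ND. Qed.

(** Diagonal type for the abelian subgroup generated by x^2 and y: the letters a0, b0
    and d1 form a triangle with self-braidings and edges -1, and
    ad a0 (ad b0 (d1)) has degree x^2 y (x^2 y) = 1.  The operator dual to the word
    b0 a0 d1 is the one that does not vanish on it; the order a0 b0 d1 would give
    0. *)
Lemma triangle_central_infinite (P Q R : pred (yd_base V))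
    a0 a1 b0 b1 d0 d1 Fa0 Fa1 Fb0 Fb1 Fd0 Fd1 :
  block P (x ^+ 2)%g (x ^+ 2)%g a0 a1 Fa0 Fa1 -> central_table x y a0 a1 ->
  block Q y (x ^+ 2 * y)%g b0 b1 Fb0 Fb1 -> reflection_table x y (-1) b0 b1 ->
  block R y (x ^+ 2 * y)%g d0 d1 Fd0 Fd1 -> reflection_table x y 1 d0 d1 ->
  disj P Q -> disj P R -> disj Q R ->
  ~ finite_dim_quotient N.
Proof.
move=> bA [xa0 xa1 ya0 ya1] bB [xb0 xb1 yb0 yb1] bD [xd0 xd1 yd0 yd1] PQ PR QR.
pose J := predU P Q.
have sJ : stable J := stableU (block_stable bA) (block_stable bB).
have PJ : subpred P J by move=> b Pb; apply/orP; left.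
have QJ : subpred Q J by move=> b Qb; apply/orP; right.
have [cd0 cd1] := coinv_disjoint bD (disjU PR QR).
pose w := bracket y (gen b0) (gen d1); pose z := bracket (x ^+ 2)%g (gen a0) w.
have cz : coinv J z.
  apply: coinv_bracket (supportedS PJ (block_sup0 bA)) (block_hom0 bA) _ => //.
  exact: coinv_bracket (supportedS QJ (block_sup0 bB)) (block_hom0 bB) _.
pose D : {linear A -> A} := fder Fb0 \o (fder Fa0 \o fder Fd1).
have sk : skew_on (coinv (A := A) J) 1%g D.
  have <- : (y * (x ^+ 2 * (x ^+ 2 * y)) = 1)%g by dihedral hy hx hyxy.
  apply: (skew_comp (block_homF0 bB)) => [b /(block_supF0 bB)/QJ //|].
  apply: (skew_comp (block_homF0 bA)) => [b /(block_supF0 bA)/PJ //|].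
  exact: fder_skew (block_homF1 bD).
have [dA0 _ _ _] := fder_block bA; have [dB0 _ _ _] := fder_block bB.
have [_ _ _ dD1] := fder_block bD.
have dAB0 := fder_disjoint (block_supF0 bA) (block_sup0 bB) PQ.
have dBA0 := fder_disjoint (block_supF0 bB) (block_sup0 bA) (disjC PQ).
have dDA0 := fder_disjoint (block_supF1 bD) (block_sup0 bA) (disjC PR).
have dDB0 := fder_disjoint (block_supF1 bD) (block_sup0 bB) (disjC QR).
apply: (power_infinite char0 _ sk cz (c := - 4%:R)).
- by apply: ideal_comp; [|apply: ideal_comp]; apply: fder_ideal.
- exact: ba_act1.
- have yd : act y (gen d1) = - gen d1 by rewrite act_gen yd1 scale1r linearN.
  have x2d : act (x ^+ 2)%g (gen d1) = gen d1.
    by rewrite expgS ba_actC !act_gen xd1 scale1r xd0.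
  have x2b : act (x ^+ 2)%g (gen b0) = - gen b0.
    by rewrite expgS ba_actC !act_gen xb0 xb1 scaleN1r linearN.
  have yb : act y (gen b0) = - gen b0 by rewrite act_gen yb0 linearN.
  have ya : act y (gen a0) = gen a0 by rewrite act_gen ya0.
  have x2a : act (x ^+ 2)%g (gen a0) = - gen a0.
    by rewrite expgS ba_actC !act_gen xa0 xa1 linearN.
  have hD := block_homF1 bD; have hA := block_homF0 bA.
  have wE : w = gen b0 * gen d1 + gen d1 * gen b0 by rewrite /w /bracket yd mulNr opprK.
  have zE : z = gen a0 * w + w * gen a0.
    rewrite /z /bracket wE linearD /= !ba_actM x2d x2b mulNr mulrN -opprD.
    by rewrite mulNr opprK.
  have dw : fder Fd1 w = gen b0 *+ 2.
    rewrite wE linearD /= !(fderM _ _ hD) dD1 dDB0 mulr0 mul0r addr0 add0r.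
    by rewrite mulr1 mul1r ba_actC yb linearN /= x2b opprK.
  have dz : fder Fd1 z = (gen a0 * gen b0 - gen b0 * gen a0) *+ 2.
    rewrite zE linearD /= !(fderM _ _ hD) dw dDA0 mul0r mulr0 addr0 add0r.
    by rewrite ba_actC ya x2a mulrnAr mulrnAl mulrN -mulrnDl.
  rewrite /D /= dz linearMn linearB /= !(fderM _ _ hA) dA0 dAB0.
  rewrite !(mulr0, mul0r, addr0, add0r, mulr1, mul1r) x2b.
  rewrite linearMn linearB linearN /= dB0 -opprD.
  by rewrite -!mulr2n scaleNr mulNrn -mulrnA scaler_nat.
by rewrite oppr_eq0 ((pcharf0P _).1 char0).
Qed.

Lemma actN h z : act h (- z) = - act h z. Proof. exact: linearN. Qed.
Lemma actZ h c z : act h (c *: z) = c *: act h z. Proof. exact: linearZ. Qed.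
Lemma actD h z t : act h (z + t) = act h z + act h t. Proof. exact: linearD. Qed.
Lemma fderN F z : fder F (- z) = - fder F z. Proof. exact: linearN. Qed.
Lemma fderZ F c z : fder F (c *: z) = c *: fder F z. Proof. exact: linearZ. Qed.
Lemma fderD F z t : fder F (z + t) = fder F z + fder F t. Proof. exact: linearD. Qed.

Lemma act_inv g z a : a != 0 -> act g z = a *: z -> act g^-1%g z = a^-1 *: z.
Proof.
move=> a0 gz; rewrite -{1}[z](scalerK a0) -gz linearZ /= -ba_actC mulVg.
by rewrite ba_act1.
Qed.

Lemma act_inj g : injective (act g).
Proof. by move=> a b /(congr1 (act g^-1%g)); rewrite -!ba_actC mulVg !ba_act1. Qed.

Lemma reflection_act s e u0 u1 : reflection_table x s e u0 u1 ->
  [/\ act x (gen u0) = gen u1, act x (gen u1) = e *: gen u0,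
      act s (gen u0) = - gen u0 & act s (gen u1) = - (e *: gen u1)].
Proof.
by move=> [xu0 xu1 su0 su1]; rewrite !act_gen xu0 xu1 su0 su1 !linearN !linearZ.
Qed.

Lemma reflection_act_shift e u0 u1 : e * e = 1 ->
  reflection_table x (x * y)%g e u0 u1 ->
  act y (gen u0) = - (e *: gen u1) /\ act y (gen u1) = - (e *: gen u0).
Proof.
move=> ee /reflection_act[xu0 xu1 su0 su1].
split; apply: (act_inj (g := x)); rewrite -ba_actC.
  by rewrite su0 actN actZ xu1 scalerA ee scale1r.
by rewrite su1 actN actZ xu0.
Qed.

Lemma reflection_sq s e u0 u1 : reflection_table x s e u0 u1 ->
  act (x ^+ 2)%g (gen u0) = e *: gen u0 /\ act (x ^+ 2)%g (gen u1) = e *: gen u1.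
Proof.
move=> /reflection_act[xu0 xu1 _ _].
rewrite -[(x ^+ 2)%g]/(x * x)%g !ba_actC xu0 xu1; split=> //.
by rewrite actZ xu0.
Qed.

(** The commutators of a reflection block for y, on which x^2 acts by e, with one for
    x y, on which x^2 acts by f.  mixed00 and mixed11 have degree x^-1, mixed01 and
    mixed10 have degree x.  The squared braiding has eigenvalues 1, -1 if e f = 1,
    and i, -i if e f = -1. *)
Section ReflectionPair.
Context (P Q : pred (yd_base V)) (e f : k) (b0 b1 d0 d1 : {malg k[yd_base V]})
  (Fb0 Fb1 Fd0 Fd1 : yd_base V -> k) (ee : e * e = 1) (ff : f * f = 1).
Context (bB : block P y (x ^+ 2 * y)%g b0 b1 Fb0 Fb1)
  (tB : reflection_table x y e b0 b1).
Context (bD : block Q (x * y)%g (x ^+ 2 * (x * y))%g d0 d1 Fd0 Fd1)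
  (tD : reflection_table x (x * y)%g f d0 d1) (PQ : disj P Q).

Definition mixed00 : A := bracket y (gen b0) (gen d0).
Definition mixed01 : A := bracket y (gen b0) (gen d1).
Definition mixed10 : A := bracket (x ^+ 2 * y)%g (gen b1) (gen d0).
Definition mixed11 : A := bracket (x ^+ 2 * y)%g (gen b1) (gen d1).

Lemma mixedE :
  [/\ mixed00 = gen b0 * gen d0 + f *: (gen d1 * gen b0),
      mixed01 = gen b0 * gen d1 + f *: (gen d0 * gen b0),
      mixed10 = gen b1 * gen d0 + gen d1 * gen b1 &
      mixed11 = gen b1 * gen d1 + gen d0 * gen b1].
Proof.
have [yD0 yD1] := reflection_act_shift ff tD.
have [x2D0 x2D1] := reflection_sq tD.
split.
- by rewrite /mixed00 /bracket yD0 mulNr opprK scalerAl.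
- by rewrite /mixed01 /bracket yD1 mulNr opprK scalerAl.
- rewrite /mixed10 /bracket ba_actC yD0 actN actZ x2D1 scalerA ff scale1r.
  by rewrite mulNr opprK.
rewrite /mixed11 /bracket ba_actC yD1 actN actZ x2D0 scalerA ff scale1r.
by rewrite mulNr opprK.
Qed.

Lemma mixed_act :
  [/\ act x mixed00 = mixed11, act x mixed11 = (e * f) *: mixed00,
      act x mixed01 = f *: mixed10 & act x mixed10 = e *: mixed01].
Proof.
have [E00 E01 E10 E11] := mixedE.
have [xB0 xB1 _ _] := reflection_act tB; have [xD0 xD1 _ _] := reflection_act tD.
split; rewrite ?E00 ?E01 ?E10 ?E11 !(actD, actZ) !ba_actM xD0 xD1 ?xB0 ?xB1
  -?scalerAl -?ba_scaleAr !(scalerDr, scalerA) -?scalerAl -?ba_scaleAr ?scalerA.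
- by rewrite ff scale1r.
- by rewrite -mulrA ff mulr1 mulrC.
- by [].
by rewrite [f * e]mulrC.
Qed.

Lemma mixed_coinv (J : pred (yd_base V)) : stable J -> subpred P J -> disj J Q ->
  [/\ coinv J mixed00, coinv J mixed01, coinv J mixed10 & coinv J mixed11].
Proof.
move=> sJ PJ JQ; have [cd0 cd1] := coinv_disjoint bD JQ.
have sb0 := supportedS PJ (block_sup0 bB); have sb1 := supportedS PJ (block_sup1 bB).
by split; apply: coinv_bracket => //;
  [exact: block_hom0 bB | exact: block_hom0 bB |
   exact: block_hom1 bB | exact: block_hom1 bB].
Qed.

Lemma mixed_der0 :
  [/\ fder Fd0 mixed00 = gen b0, fder Fd0 mixed01 = - (f *: gen b1),
      fder Fd0 mixed10 = gen b1 & fder Fd0 mixed11 = - gen b0].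
Proof.
have [E00 E01 E10 E11] := mixedE.
have [xB0 xB1 yB0 yB1] := reflection_act tB.
have [dD0 dD1 _ _] := fder_block bD.
have dB0 := fder_disjoint (block_supF0 bD) (block_sup0 bB) (disjC PQ).
have dB1 := fder_disjoint (block_supF0 bD) (block_sup1 bB) (disjC PQ).
have act0 : act (x * y)%g (gen b0) = - gen b1 by rewrite ba_actC yB0 actN xB0.
have act1 : act (x * y)%g (gen b1) = - gen b0.
  by rewrite ba_actC yB1 actN actZ xB1 scalerA ee scale1r.
have hD := block_homF0 bD.
rewrite E00 E01 E10 E11 !fderD !fderZ !(fderM _ _ hD) dD0 dD1 dB0 dB1 act0 act1.
by split; rewrite !(mulr0, mul0r, mulr1, mul1r, addr0, add0r, scaler0) ?scalerN.
Qed.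

Lemma mixed_der1 :
  [/\ fder Fd1 mixed00 = - ((e * f) *: gen b1), fder Fd1 mixed01 = gen b0,
      fder Fd1 mixed10 = - (e *: gen b0) & fder Fd1 mixed11 = gen b1].
Proof.
have [E00 E01 E10 E11] := mixedE.
have [xB0 xB1 yB0 yB1] := reflection_act tB; have [x2B0 x2B1] := reflection_sq tB.
have [_ _ dD0 dD1] := fder_block bD.
have dB0 := fder_disjoint (block_supF1 bD) (block_sup0 bB) (disjC PQ).
have dB1 := fder_disjoint (block_supF1 bD) (block_sup1 bB) (disjC PQ).
have act0 : act (x ^+ 2 * (x * y))%g (gen b0) = - (e *: gen b1).
  by rewrite ba_actC ba_actC yB0 actN xB0 actN x2B1.
have act1 : act (x ^+ 2 * (x * y))%g (gen b1) = - (e *: gen b0).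
  by rewrite ba_actC ba_actC yB1 actN actZ xB1 scalerA ee scale1r actN x2B0.
have hD := block_homF1 bD.
rewrite E00 E01 E10 E11 !fderD !fderZ !(fderM _ _ hD) dD0 dD1 dB0 dB1 act0 act1.
by split; rewrite !(mulr0, mul0r, mulr1, mul1r, addr0, add0r, scaler0) ?scalerN
  ?scalerA ?[f * e]mulrC.
Qed.

(** Operators dual to the words b0 d0 and b0 d1, of degrees x^-1 and x. *)
Lemma mixed_skew0 : skew_on (coinv (A := A) P) x^-1%g (fder Fb0 \o fder Fd0).
Proof.
have <- : (y * (x * y) = x^-1)%g by dihedral hy hx hyxy.
apply: (skew_comp (block_homF0 bB) (block_supF0 bB)).
exact: fder_skew (block_homF0 bD).
Qed.

Lemma mixed_skew1 : skew_on (coinv (A := A) P) x (fder Fb0 \o fder Fd1).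
Proof.
have <- : (y * (x ^+ 2 * (x * y)) = x)%g by dihedral hy hx hyxy.
apply: (skew_comp (block_homF0 bB) (block_supF0 bB)).
exact: fder_skew (block_homF1 bD).
Qed.

End ReflectionPair.

(** A triangle as in [triangle_central_infinite], now with noncommuting degrees x, y
    and x y.  The commutator z = ad a0 (ad b0 (d0)) has degree x y (x y) = 1, and the
    dual word is b1 a0 d0, of degree x^2 y x (x y) = 1. *)
Lemma triangle_outer_infinite (P Q R : pred (yd_base V)) e
    a0 a1 b0 b1 d0 d1 Fa0 Fa1 Fb0 Fb1 Fd0 Fd1 : e * e = 1 ->
  block P x x^-1%g a0 a1 Fa0 Fa1 -> rotation_table x y a0 a1 ->
  block Q y (x ^+ 2 * y)%g b0 b1 Fb0 Fb1 -> reflection_table x y e b0 b1 ->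
  block R (x * y)%g (x ^+ 2 * (x * y))%g d0 d1 Fd0 Fd1 ->
  reflection_table x (x * y)%g e d0 d1 ->
  disj P Q -> disj P R -> disj Q R ->
  ~ finite_dim_quotient N.
Proof.
move=> ee bA [xa0 xa1 ya0 ya1] bB tB bD tD PQ PR QR.
pose J := predU P Q.
have sJ : stable J := stableU (block_stable bA) (block_stable bB).
have PJ : subpred P J by move=> b Pb; apply/orP; left.
have QJ : subpred Q J by move=> b Qb; apply/orP; right.
pose w := mixed00 b0 d0; pose z := bracket x (gen a0) w.
have [cw _ _ _] := mixed_coinv bB bD sJ QJ (disjU PR QR).
have cz : coinv J z.
  exact: coinv_bracket (supportedS PJ (block_sup0 bA)) (block_hom0 bA) cw.
pose D : {linear A -> A} := fder Fb1 \o (fder Fa0 \o fder Fd0).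
have sk : skew_on (coinv (A := A) J) 1%g D.
  have <- : (x ^+ 2 * y * (x * (x * y)) = 1)%g by dihedral hy hx hyxy.
  apply: (skew_comp (block_homF1 bB)) => [b /(block_supF1 bB)/QJ //|].
  apply: (skew_comp (block_homF0 bA)) => [b /(block_supF0 bA)/PJ //|].
  exact: fder_skew (block_homF0 bD).
have [dA0 dA1 _ _] := fder_block bA; have [_ _ dB0 dB1] := fder_block bB.
have dAB0 := fder_disjoint (block_supF0 bA) (block_sup0 bB) PQ.
have dDA0 := fder_disjoint (block_supF0 bD) (block_sup0 bA) (disjC PR).
have [xw _ _ _] := mixed_act ee tB tD.
have [dw _ _ dxw] := mixed_der0 ee ee bB tB bD tD QR.
apply: (power_infinite char0 _ sk cz (c := 1)); last exact: oner_neq0.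
- by apply: ideal_comp; [|apply: ideal_comp]; apply: fder_ideal.
- exact: ba_act1.
- have hD := block_homF0 bD; have hA := block_homF0 bA.
  have [xB0 _ _ _] := reflection_act tB.
  have xya : act (x * y)%g (gen a0) = - gen a1.
    by rewrite ba_actC !act_gen ya0 xa1 linearN.
  have dz : fder Fd0 z = gen a0 * gen b0 - gen b0 * gen a1.
    rewrite /z /bracket xw fderD fderN !(fderM _ _ hD) dw dxw dDA0.
    by rewrite mul0r mulr0 addr0 add0r xya mulrN mulNr opprK.
  rewrite /D /= dz fderD fderN !(fderM _ _ hA) dA0 dA1 dAB0.
  by rewrite !(mulr0, mul0r, addr0, add0r) subr0 mul1r xB0 dB1 scale1r.
Qed.

Context (im : k) (im2 : im * im = -1).

Lemma two_neq0 : 2%:R != 0 :> k.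
Proof. by rewrite ((pcharf0P _).1 char0). Qed.

Lemma im_neq0 : im != 0.
Proof. by apply: contra_eq_neq im2 => ->; rewrite mul0r eq_sym oppr_eq0 oner_eq0. Qed.

Lemma im_neqN : im != - im.
Proof.
rewrite -addr_eq0 -mulr2n -mulr_natl mulf_neq0 //; [exact: two_neq0 | exact: im_neq0].
Qed.

Lemma one_sub_im : 1 - im != 0.
Proof.
rewrite subr_eq0; apply: contra_eq_neq im2 => <-.
by rewrite mulr1 -addr_eq0 -mulr2n two_neq0.
Qed.

(** Here x acts on the commutators of degree x with square -1, and likewise on those
    of degree x^-1.  Eigenvectors for i and -i respectively form a pair of type
    affine A_1. *)
Lemma opposite_reflections_infinite (P Q : pred (yd_base V)) e
    b0 b1 d0 d1 Fb0 Fb1 Fd0 Fd1 : e * e = 1 ->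
  block P y (x ^+ 2 * y)%g b0 b1 Fb0 Fb1 -> reflection_table x y e b0 b1 ->
  block Q (x * y)%g (x ^+ 2 * (x * y))%g d0 d1 Fd0 Fd1 ->
  reflection_table x (x * y)%g (- e) d0 d1 ->
  disj P Q -> ~ finite_dim_quotient N.
Proof.
move=> ee bB tB bD tD PQ.
have eN : - e * - e = 1 by rewrite mulrNN.
have eeN : e * - e = -1 by rewrite mulrN ee.
have [dB0 dB1 _ _] := fder_block bB.
have [x00 x11 x01 x10] := mixed_act eN tB tD.
have [c00 c01 c10 c11] := mixed_coinv bB bD (block_stable bB) (fun b h => h) PQ.
have [D00 D01 D10 D11] := mixed_der0 ee eN bB tB bD tD PQ.
have [T00 T01 T10 T11] := mixed_der1 ee eN bB tB bD tD PQ.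
have sk0 := mixed_skew0 bB bD; have sk1 := mixed_skew1 bB bD.
move: (mixed00 _ _) (mixed01 _ _) (mixed10 _ _) (mixed11 _ _)
  x00 x11 x01 x10 c00 c01 c10 c11 D00 D01 D10 D11 T00 T01 T10 T11 =>
  w00 w01 w10 w11 x00 x11 x01 x10 c00 c01 c10 c11 D00 D01 D10 D11 T00 T01 T10 T11.
apply: (pair_infinite char0 (Dn := fder Fb0 \o fder Fd1) (Dp := fder Fb0 \o fder Fd0)
  (n := w01 + (e * im) *: w10) (p := w00 + im *: w11)
  (nu := im) (lam := - im) (cn := 1 - im) (cp := 1 - im) _ _ sk1 sk0).
- by apply: ideal_comp; apply: fder_ideal.
- by apply: ideal_comp; apply: fder_ideal.
- by apply: coinvD => //; apply: coinvZ.
- by apply: coinvD => //; apply: coinvZ.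
- rewrite actD actZ x01 x10 scalerDr !scalerA addrC.
  congr (_ *: _ + _ *: _); first by rewrite mulrAC ee mul1r.
  by rewrite mulrCA im2 mulrN1.
- rewrite actD actZ x00 x11 eeN scalerDr !scalerA mulrN1 mulNr im2 opprK.
  by rewrite scale1r addrC.
- exact: im_neq0.
- by rewrite oppr_eq0 im_neq0.
- exact: im_neqN.
- rewrite /= fderD fderZ T01 T10 fderD fderZ fderN fderZ dB0.
  by rewrite scalerN scalerA mulrAC ee mul1r scalerBl scale1r.
- by rewrite /= fderD fderZ D00 D11 fderD fderZ fderN dB0 scalerN scalerBl scale1r.
- by rewrite /= fderD fderZ T00 T11 fderD fderN !fderZ dB1 !scaler0 oppr0 addr0.
- by rewrite /= fderD fderZ D01 D10 fderD fderN !fderZ dB1 !scaler0 oppr0 addr0.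
- exact: one_sub_im.
exact: one_sub_im.
Qed.

(** [pair_infinite] for n = ad u1 (w1) and p = ad u2 (w2), where u1, u2 are letters and
    w1, w2 may themselves be commutators with letters in Q: the operators D1, D2 dual
    to them are only skew on the coinvariants of Q.  Either D1 kills w2 or the
    derivation along F1 kills u2, whence the products d12 * f12 and d21 * f21. *)
Lemma bracket_pair_infinite (P Q : pred (yd_base V)) g g1 g2 h1 h2
    u1 u2 F1 F2 w1 w2 (D1 D2 : {linear A -> A}) c1 c2 d12 d21 f12 f21
    a1 a2 b1 b2 s1 s2 t1 t2 r1 r2 :
  subpred Q P -> stable P ->
  supported P u1 -> homog g1 u1 -> (forall b, F1 b != 0 -> P b) ->
  homog_functional g1 F1 -> fder F1 (gen u1) = 1 -> fder F1 (gen u2) = f12 *: 1 ->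
  supported P u2 -> homog g2 u2 -> (forall b, F2 b != 0 -> P b) ->
  homog_functional g2 F2 -> fder F2 (gen u2) = 1 -> fder F2 (gen u1) = f21 *: 1 ->
  coinv P w1 -> coinv P w2 -> coinv Q (gen u1) -> coinv Q (gen u2) ->
  (forall x, N x -> N (D1 x)) -> (forall x, N x -> N (D2 x)) ->
  skew_on (coinv (A := A) Q) h1 D1 -> skew_on (coinv (A := A) Q) h2 D2 ->
  D1 (gen u1) = 0 -> D1 (gen u2) = 0 -> D2 (gen u1) = 0 -> D2 (gen u2) = 0 ->
  D1 w1 = c1 *: 1 -> D1 w2 = d12 *: 1 -> D2 w2 = c2 *: 1 -> D2 w1 = d21 *: 1 ->
  d12 * f12 = 0 -> d21 * f21 = 0 -> c1 != 0 -> c2 != 0 ->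
  act g1 w1 = s1 *: w1 -> act h1 (gen u1) = t1 *: gen u1 -> 1 - s1 * t1 != 0 ->
  act g2 w2 = s2 *: w2 -> act h2 (gen u2) = t2 *: gen u2 -> 1 - s2 * t2 != 0 ->
  act h1 (gen u2) = r1 *: gen u2 -> act h2 (gen u1) = r2 *: gen u1 ->
  (g1 * h1 = g)%g -> (g2 * h2 = g^-1)%g ->
  act g (gen u1) = a1 *: gen u1 -> act g w1 = b1 *: w1 ->
  act g (gen u2) = a2 *: gen u2 -> act g w2 = b2 *: w2 ->
  a1 * b1 != 0 -> a2 * b2 != 0 -> a1 * b1 != a2 * b2 ->
  ~ finite_dim_quotient N.
Proof.
move=> QP sP su1 hu1 sF1 hF1 F11 F12 su2 hu2 sF2 hF2 F22 F21 cw1 cw2 cu1 cu2.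
move=> N1 N2 sk1 sk2 D1u1 D1u2 D2u1 D2u2 D1w1 D1w2 D2w2 D2w1 df12 df21 c10 c20.
move=> gw1 hu1t st1 gw2 hu2t st2 hu12 hu21 gh1 gh2 gu1 gww1 gu2 gww2 ab1 ab2 ab12.
have coinvQ z : coinv P z -> coinv Q z by move=> cz h b /QP; apply: cz.
have E1 : bracket g1 (gen u1) w1 = gen u1 * w1 - s1 *: (w1 * gen u1).
  by rewrite /bracket gw1 scalerAl.
have E2 : bracket g2 (gen u2) w2 = gen u2 * w2 - s2 *: (w2 * gen u2).
  by rewrite /bracket gw2 scalerAl.
have eig u w a b s : act g (gen u) = a *: gen u -> act g w = b *: w ->
    act g (gen u * w - s *: (w * gen u)) =
    (a * b) *: (gen u * w - s *: (w * gen u)).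
  move=> gu gw; rewrite actD actN actZ !ba_actM gu gw -!scalerAl -!ba_scaleAr !scalerA.
  by rewrite scalerBr !scalerA; congr (_ - _ *: _); ring.
have der (D : {linear A -> A}) h u w c s t : skew_on (coinv (A := A) Q) h D ->
    coinv Q (gen u) -> coinv P w -> D (gen u) = 0 -> D w = c *: 1 ->
    act h (gen u) = t *: gen u ->
    D (gen u * w - s *: (w * gen u)) = (c * (1 - s * t)) *: gen u.
  move=> sk cu /coinvQ cw Du Dw hu.
  rewrite linearB linearZ /= !sk // Du Dw hu mulr0 mul0r addr0 add0r.
  rewrite -ba_scaleAr -scalerAl mulr1 mul1r !scalerA -scalerBl.
  by congr (_ *: _); ring.
rewrite -gh1 in gu1 gww1 gu2 gww2 gh2 eig.
have K1 := skew_comp hF1 sF1; have K2 := skew_comp hF2 sF2.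
have skP h (D : {linear A -> A}) :
    skew_on (coinv (A := A) Q) h D -> skew_on (coinv (A := A) P) h D.
  by move=> sk a b /coinvQ ca /coinvQ cb; apply: sk.
have {}K1 := K1 _ _ _ (skP _ _ sk1).
have := K2 _ _ _ (skP _ _ sk2); rewrite gh2 => {}K2.
apply: (pair_infinite char0 (Dn := fder F1 \o D1) (Dp := fder F2 \o D2)
  (n := gen u1 * w1 - s1 *: (w1 * gen u1)) (p := gen u2 * w2 - s2 *: (w2 * gen u2))
  (nu := a1 * b1) (lam := a2 * b2) (cn := c1 * (1 - s1 * t1))
  (cp := c2 * (1 - s2 * t2)) _ _ K1 K2).
- by apply: ideal_comp => //; apply: fder_ideal.
- by apply: ideal_comp => //; apply: fder_ideal.
- by rewrite -E1; apply: coinv_bracket.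
- by rewrite -E2; apply: coinv_bracket.
- exact: eig.
- exact: eig.
- by [].
- by [].
- by [].
- by rewrite /= (der _ _ _ _ _ _ _ sk1 cu1 cw1 D1u1 D1w1 hu1t) fderZ F11.
- by rewrite /= (der _ _ _ _ _ _ _ sk2 cu2 cw2 D2u2 D2w2 hu2t) fderZ F22.
- rewrite /= (der _ _ _ _ _ _ _ sk1 cu2 cw2 D1u2 D1w2 hu12) fderZ F12 scalerA mulrAC.
  by rewrite df12 mul0r scale0r.
- rewrite /= (der _ _ _ _ _ _ _ sk2 cu1 cw1 D2u1 D2w1 hu21) fderZ F21 scalerA mulrAC.
  by rewrite df21 mul0r scale0r.
- by rewrite mulf_neq0.
by rewrite mulf_neq0.
Qed.

Lemma supported_comb (P : pred (yd_base V)) c u v :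
  supported P u -> supported P v -> supported P (u + c *: v).
Proof.
move=> su sv b; apply: contraNT => nP; rewrite mcoeffD mcoeffZ.
have /contraNeq/(_ nP)-> := su b; have /contraNeq/(_ nP)-> := sv b.
by rewrite mulr0 addr0.
Qed.

Lemma homog_comb g c (u v : {malg k[yd_base V]}) :
  homog g u -> homog g v -> homog g (u + c *: v).
Proof.
move=> hu hv b nz; apply/eqP; move: b nz.
by apply: supported_comb => b nz; apply/eqP; [apply: hu | apply: hv].
Qed.

Lemma central_eigen u0 u1 i : i * i = -1 -> central_table x y u0 u1 ->
  act x (gen (u0 + i *: u1)) = - i *: gen (u0 + i *: u1).
Proof.
move=> ii [xu0 xu1 _ _]; rewrite act_gen -linearZ; congr (gen _).
rewrite linearD linearZ /= xu0 xu1 scalerDr scalerA mulNr ii opprK scale1r addrC.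
by rewrite scalerN scaleNr.
Qed.

Lemma act_invx i u : i * i = -1 -> act x u = i *: u -> act x^-1%g u = - i *: u.
Proof.
move=> ii xu; have i0 : i != 0.
  by apply: contra_eq_neq ii => ->; rewrite mul0r eq_sym oppr_eq0 oner_eq0.
rewrite (act_inv i0 xu); congr (_ *: _); apply: (mulfI i0).
by rewrite mulrN ii opprK mulfV.
Qed.

(** A four-cycle: eigenvectors of x for -i and i in the central block, joined with two
    elements w1, w0 of degrees x^-1 and x on which x acts by -1.  The w's are letters
    in one application and commutators in the other. *)
Lemma central_rotation_infinite (P Q R : pred (yd_base V))
    a0 a1 Fa0 Fa1 w0 w1 (D0 D1 : {linear A -> A}) c :
  block P (x ^+ 2)%g (x ^+ 2)%g a0 a1 Fa0 Fa1 -> central_table x y a0 a1 ->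
  subpred R Q -> subpred P Q -> stable Q ->
  coinv R (gen a0) -> coinv R (gen a1) -> coinv Q w0 -> coinv Q w1 ->
  (forall x, N x -> N (D0 x)) -> (forall x, N x -> N (D1 x)) ->
  skew_on (coinv (A := A) R) x D0 -> skew_on (coinv (A := A) R) x^-1%g D1 ->
  D0 (gen a0) = 0 -> D0 (gen a1) = 0 -> D1 (gen a0) = 0 -> D1 (gen a1) = 0 ->
  D0 w0 = c *: 1 -> D0 w1 = 0 -> D1 w0 = 0 -> D1 w1 = c *: 1 -> c != 0 ->
  act x w0 = - w0 -> act x w1 = - w1 ->
  ~ finite_dim_quotient N.
Proof.
move=> bA tA RQ PQ sQ ca0 ca1 cw0 cw1 N0 N1 sk0 sk1 D00 D01 D10 D11 Dw00 Dw01 Dw10 Dw11.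
move=> c0 xw0 xw1.
have [dA0 dA1 _ _] := fder_block bA.
have imN2 : - im * - im = -1 by rewrite mulrNN.
have sup i : supported Q (a0 + i *: a1).
  by apply: supported_comb; apply: (supportedS PQ);
    [exact: block_sup0 bA | exact: block_sup1 bA].
have hom i : homog (x ^+ 2)%g (a0 + i *: a1).
  by apply: homog_comb; [exact: block_hom0 bA|exact: block_hom1 bA].
have sF b : Fa0 b != 0 -> Q b by move/(block_supF0 bA)/PQ.
have F1 i : fder Fa0 (gen (a0 + i *: a1)) = 1.
  by rewrite linearD linearZ /= fderD fderZ dA0 dA1 scaler0 addr0.
have coi i : coinv R (gen (a0 + i *: a1)).
  by rewrite linearD linearZ; apply: coinvD => //; apply: coinvZ.
have Dz (D : {linear A -> A}) i : D (gen a0) = 0 -> D (gen a1) = 0 ->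
    D (gen (a0 + i *: a1)) = 0.
  by move=> d0 d1; rewrite !linearD !linearZ /= d0 d1 scaler0 addr0.
have x2w w : act x w = - w -> act (x ^+ 2)%g w = 1 *: w.
  by move=> xw; rewrite -[(x ^+ 2)%g]/(x * x)%g ba_actC xw actN xw opprK scale1r.
have xp := central_eigen im2 tA; have xm := central_eigen imN2 tA.
rewrite opprK in xm.
have xVp := act_invx imN2 xp; have xVm := act_invx im2 xm.
rewrite opprK in xVp.
have zero : (0 : A) = 0 *: 1 by rewrite scale0r.
apply: (@bracket_pair_infinite Q R x (x ^+ 2) (x ^+ 2) x^-1 x
  (a0 + im *: a1) (a0 + (- im) *: a1)
  Fa0 Fa0 w1 w0 D1 D0 c c 0 0 1 1 (- im) im (-1) (-1) 1 1 im im (- im) (- im)) => //.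
- exact: block_homF0 bA.
- by rewrite F1 scale1r.
- exact: block_homF0 bA.
- by rewrite F1 scale1r.
- exact: Dz.
- exact: Dz.
- exact: Dz.
- exact: Dz.
- by rewrite Dw10 scale0r.
- by rewrite Dw01 scale0r.
- by rewrite mul0r.
- by rewrite mul0r.
- exact: x2w.
- by rewrite mul1r one_sub_im.
- exact: x2w.
- by rewrite mul1r one_sub_im.
- by dihedral hy hx hyxy.
- by dihedral hy hx hyxy.
- by rewrite scaleN1r.
- by rewrite scaleN1r.
- by rewrite mulrN1 opprK im_neq0.
- by rewrite mulrN1 oppr_eq0 im_neq0.
by rewrite !mulrN1 opprK im_neqN.
Qed.

Lemma central_rotation_pair_infinite (P Q : pred (yd_base V))
    a0 a1 b0 b1 Fa0 Fa1 Fb0 Fb1 :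
  block P (x ^+ 2)%g (x ^+ 2)%g a0 a1 Fa0 Fa1 -> central_table x y a0 a1 ->
  block Q x x^-1%g b0 b1 Fb0 Fb1 -> rotation_table x y b0 b1 ->
  disj P Q -> ~ finite_dim_quotient N.
Proof.
move=> bA tA bB [xb0 xb1 _ _] PQ; have QP := disjC PQ.
have [cb0 cb1] := coinv_disjoint bB PQ.
have [dB0 dB01 dB10 dB1] := fder_block bB.
apply: (central_rotation_infinite (P := P) (Q := P) (R := pred0) (c := 1)
  (w0 := gen b0) (w1 := gen b1) (D0 := fder Fb0) (D1 := fder Fb1) bA tA) => //.
- exact: block_stable bA.
- by move=> z; apply: fder_ideal.
- by move=> z; apply: fder_ideal.
- exact: fder_skew (block_homF0 bB).
- exact: fder_skew (block_homF1 bB).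
- exact: fder_disjoint (block_supF0 bB) (block_sup0 bA) QP.
- exact: fder_disjoint (block_supF0 bB) (block_sup1 bA) QP.
- exact: fder_disjoint (block_supF1 bB) (block_sup0 bA) QP.
- exact: fder_disjoint (block_supF1 bB) (block_sup1 bA) QP.
- by rewrite scale1r.
- by rewrite scale1r.
- exact: oner_neq0.
- by rewrite act_gen xb0 linearN.
by rewrite act_gen xb1 linearN.
Qed.

(** The commutators of the two reflection blocks contain a rotation block: mixed00 -
    mixed11 and mixed01 - e mixed10, of degrees x^-1 and x, are negated by x. *)
Lemma central_reflections_infinite (P Q R : pred (yd_base V)) e
    a0 a1 b0 b1 d0 d1 Fa0 Fa1 Fb0 Fb1 Fd0 Fd1 : e * e = 1 ->
  block P (x ^+ 2)%g (x ^+ 2)%g a0 a1 Fa0 Fa1 -> central_table x y a0 a1 ->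
  block Q y (x ^+ 2 * y)%g b0 b1 Fb0 Fb1 -> reflection_table x y e b0 b1 ->
  block R (x * y)%g (x ^+ 2 * (x * y))%g d0 d1 Fd0 Fd1 ->
  reflection_table x (x * y)%g e d0 d1 ->
  disj P Q -> disj P R -> disj Q R ->
  ~ finite_dim_quotient N.
Proof.
move=> ee bA tA bB tB bD tD PQ PR QR.
pose J := predU P Q.
have sJ : stable J := stableU (block_stable bA) (block_stable bB).
have PJ : subpred P J by move=> b Pb; apply/orP; left.
have QJ : subpred Q J by move=> b Qb; apply/orP; right.
have [ca0 ca1] := coinv_disjoint bA (disjC PQ).
have [dB0 dB1 _ _] := fder_block bB.
have dDA00 := fder_disjoint (block_supF0 bD) (block_sup0 bA) (disjC PR).
have dDA01 := fder_disjoint (block_supF0 bD) (block_sup1 bA) (disjC PR).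
have dDA10 := fder_disjoint (block_supF1 bD) (block_sup0 bA) (disjC PR).
have dDA11 := fder_disjoint (block_supF1 bD) (block_sup1 bA) (disjC PR).
have [x00 x11 x01 x10] := mixed_act ee tB tD.
have [c00 c01 c10 c11] := mixed_coinv bB bD sJ QJ (disjU PR QR).
have [D00 D01 D10 D11] := mixed_der0 ee ee bB tB bD tD QR.
have [T00 T01 T10 T11] := mixed_der1 ee ee bB tB bD tD QR.
rewrite ee in x11 T00; rewrite scale1r in x11; rewrite scale1r in T00.
have sk0 := mixed_skew0 bB bD; have sk1 := mixed_skew1 bB bD.
move: (mixed00 _ _) (mixed01 _ _) (mixed10 _ _) (mixed11 _ _)
  x00 x11 x01 x10 c00 c01 c10 c11 D00 D01 D10 D11 T00 T01 T10 T11 =>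
  w00 w01 w10 w11 x00 x11 x01 x10 c00 c01 c10 c11 D00 D01 D10 D11 T00 T01 T10 T11.
apply: (central_rotation_infinite (P := P) (Q := J) (R := Q) (c := 2%:R)
  (w0 := w01 - e *: w10) (w1 := w00 - w11)
  (D0 := fder Fb0 \o fder Fd1) (D1 := fder Fb0 \o fder Fd0) bA tA) => //.
- by apply: coinvD => //; apply/coinvN/coinvZ.
- by apply: coinvD => //; apply/coinvN.
- by apply: ideal_comp; apply: fder_ideal.
- by apply: ideal_comp; apply: fder_ideal.
- by rewrite /= dDA10 linear0.
- by rewrite /= dDA11 linear0.
- by rewrite /= dDA00 linear0.
- by rewrite /= dDA01 linear0.
- rewrite /= fderD fderN fderZ T01 T10 scalerN opprK scalerA ee scale1r.
  by rewrite fderD dB0 scaler_nat.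
- by rewrite /= fderD fderN T00 T11 -opprD fderN fderD dB1 addr0 oppr0.
- rewrite /= fderD fderN fderZ D01 D10 -opprD fderN fderD fderZ dB1.
  by rewrite scaler0 addr0 oppr0.
- by rewrite /= fderD fderN D00 D11 opprK fderD dB0 scaler_nat.
- exact: two_neq0.
- by rewrite actD actN actZ x01 x10 scalerA ee scale1r opprB.
by rewrite actD actN x00 x11 opprB.
Qed.

(** The commutators w = ad b0 (d1) and w' = ad b1 (d0) of the two reflection blocks
    have degree x^2, and x maps w to w' to -w: they form a central block. *)
Lemma rotation_reflections_infinite (P Q R : pred (yd_base V))
    a0 a1 b0 b1 d0 d1 Fa0 Fa1 Fb0 Fb1 Fd0 Fd1 :
  block P x x^-1%g a0 a1 Fa0 Fa1 -> rotation_table x y a0 a1 ->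
  block Q y (x ^+ 2 * y)%g b0 b1 Fb0 Fb1 -> reflection_table x y (-1) b0 b1 ->
  block R y (x ^+ 2 * y)%g d0 d1 Fd0 Fd1 -> reflection_table x y 1 d0 d1 ->
  disj P Q -> disj P R -> disj Q R ->
  ~ finite_dim_quotient N.
Proof.
move=> bA [xa0 xa1 _ _] bB tB bD tD PQ PR QR.
pose J := predU P Q.
have sJ : stable J := stableU (block_stable bA) (block_stable bB).
have PJ : subpred P J by move=> b Pb; apply/orP; left.
have QJ : subpred Q J by move=> b Qb; apply/orP; right.
have [cd0 cd1] := coinv_disjoint bD (disjU PR QR).
have [ca0 ca1] := coinv_disjoint bA (disjC PQ).
have [dB0 dB01 _ _] := fder_block bB.
have [_ _ dD10 dD11] := fder_block bD.
have [dA00 dA01 dA10 dA11] := fder_block bA.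
have dDB10 := fder_disjoint (block_supF1 bD) (block_sup0 bB) (disjC QR).
have dDB11 := fder_disjoint (block_supF1 bD) (block_sup1 bB) (disjC QR).
have dDA10 := fder_disjoint (block_supF1 bD) (block_sup0 bA) (disjC PR).
have dDA11 := fder_disjoint (block_supF1 bD) (block_sup1 bA) (disjC PR).
have [xB0 xB1 yB0 yB1] := reflection_act tB.
have [x2B0 x2B1] := reflection_sq tB.
have [xD0 xD1 yD0 yD1] := reflection_act tD.
have [x2D0 x2D1] := reflection_sq tD.
rewrite scaleN1r in xB1; rewrite scaleN1r opprK in yB1.
rewrite scaleN1r in x2B0; rewrite scaleN1r in x2B1.
rewrite scale1r in xD1; rewrite scale1r in yD1.
rewrite scale1r in x2D0; rewrite scale1r in x2D1.
pose w := bracket y (gen b0) (gen d1).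
pose w' := bracket (x ^+ 2 * y)%g (gen b1) (gen d0).
have E : w = gen b0 * gen d1 + gen d1 * gen b0.
  by rewrite /w /bracket yD1 mulNr opprK.
have E' : w' = gen b1 * gen d0 + gen d0 * gen b1.
  by rewrite /w' /bracket ba_actC yD0 actN x2D0 mulNr opprK.
have cw : coinv J w.
  exact: coinv_bracket (supportedS QJ (block_sup0 bB)) (block_hom0 bB) cd1.
have cw' : coinv J w'.
  exact: coinv_bracket (supportedS QJ (block_sup1 bB)) (block_hom1 bB) cd0.
have xw : act x w = w' by rewrite E E' actD !ba_actM xB0 xD1.
have xw' : act x w' = - w.
  by rewrite E E' actD !ba_actM xB1 xD0 mulNr mulrN opprD.
have h1 := block_homF1 bD.
have x2yB0 : act (x ^+ 2 * y)%g (gen b0) = gen b0.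
  by rewrite ba_actC yB0 actN x2B0 opprK.
have Dw : fder Fd1 w = gen b0 *+ 2.
  rewrite E fderD !(fderM _ _ h1) dD11 dDB10 x2yB0.
  by rewrite !(mulr0, mul0r, addr0, add0r) mulr1 mul1r.
have Dw' : fder Fd1 w' = 0.
  rewrite E' fderD !(fderM _ _ h1) dD10 dDB11.
  by rewrite !(mulr0, mul0r, addr0, add0r).
clearbody w w'.
pose D : {linear A -> A} := fder Fb0 \o fder Fd1.
have sk : skew_on (coinv (A := A) Q) (x ^+ 2)%g D.
  have <- : (y * (x ^+ 2 * y) = x ^+ 2)%g by dihedral hy hx hyxy.
  by apply: (skew_comp (block_homF0 bB) (block_supF0 bB)); apply: fder_skew h1.
have ND z : N z -> N (D z) by apply: ideal_comp; apply: fder_ideal.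
have Dwi i : D (w + i *: w') = 2%:R *: 1.
  rewrite /D /= fderD fderZ Dw Dw' scaler0 addr0 linearMn /= dB0.
  by rewrite scaler_nat.
have cwi i : coinv J (w + i *: w') by apply: coinvD => //; apply: coinvZ.
have xwi i : i * i = -1 -> act x (w + i *: w') = - i *: (w + i *: w').
  move=> ii; rewrite actD actZ xw xw' scalerDr scalerA mulNr ii opprK scale1r addrC.
  by rewrite scalerN scaleNr.
have imN2 : - im * - im = -1 by rewrite mulrNN.
have xp := xwi _ im2; have xm := xwi _ imN2; rewrite opprK in xm.
have xVp := act_invx imN2 xp; have xVm := act_invx im2 xm.
rewrite opprK in xVp.
have xA0 : act x (gen a0) = - gen a0 by rewrite act_gen xa0 linearN.
have xA1 : act x (gen a1) = - gen a1 by rewrite act_gen xa1 linearN.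
have x2A u : act x (gen u) = - gen u -> act (x ^+ 2)%g (gen u) = 1 *: gen u.
  by move=> xu; rewrite -[(x ^+ 2)%g]/(x * x)%g ba_actC xu actN xu opprK scale1r.
have DA0 : D (gen a0) = 0 by rewrite /D /= dDA10 linear0.
have DA1 : D (gen a1) = 0 by rewrite /D /= dDA11 linear0.
apply: (@bracket_pair_infinite J Q x x^-1 x (x ^+ 2) (x ^+ 2) a1 a0 Fa1 Fa0
  (w + im *: w') (w + (- im) *: w') D D 2%:R 2%:R 2%:R 2%:R 0 0
  (-1) (-1) (- im) im im im 1 1 1 1) => //.
- exact: supportedS PJ (block_sup1 bA).
- exact: block_hom1 bA.
- by move=> b /(block_supF1 bA)/PJ.
- exact: block_homF1 bA.
- by rewrite dA10 scale0r.
- exact: supportedS PJ (block_sup0 bA).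
- exact: block_hom0 bA.
- by move=> b /(block_supF0 bA)/PJ.
- exact: block_homF0 bA.
- by rewrite dA01 scale0r.
- by rewrite mulr0.
- by rewrite mulr0.
- exact: two_neq0.
- exact: two_neq0.
- exact: x2A.
- by rewrite mulr1 one_sub_im.
- exact: x2A.
- by rewrite mulr1 one_sub_im.
- exact: x2A.
- exact: x2A.
- by dihedral hy hx hyxy.
- by dihedral hy hx hyxy.
- by rewrite scaleN1r.
- by rewrite scaleN1r.
- by rewrite mulN1r opprK im_neq0.
- by rewrite mulN1r oppr_eq0 im_neq0.
by rewrite !mulN1r opprK im_neqN.
Qed.

End Triples.

(** * Summands of a direct sum *)
Lemma mext_fin (R : comNzRingType) (K : finType) (W : lmodType R) (f : K -> W)
    (u : {malg R[K]}) : mext f u = \sum_i u@_i *: f i.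
Proof.
rewrite /mext [RHS](bigID (mem (msupp u))) /= [X in _ + X]big1 ?addr0; last first.
  by move=> i iu; rewrite (mcoeff_outdom iu) scale0r.
rewrite -[RHS]big_filter; apply: perm_big; apply: uniq_perm.
- exact: fset_uniq.
- by rewrite filter_uniq // index_enum_uniq.
by move=> i; rewrite mem_filter mem_index_enum andbT.
Qed.

Lemma malg_fin (R : comNzRingType) (K : finType) (u : {malg R[K]}) :
  u = \sum_i u@_i *: << i >>.
Proof. by rewrite -mext_fin mext_id. Qed.

Section Embedding.
Context (k : fieldType) (gT : finGroupType).
Implicit Types S W X : ydModule k gT.

Record embedding S W (f : yd_base S -> yd_base W) : Prop := Embedding {
  emb_inj : injective f;
  emb_deg : forall i, yd_deg (f i) = yd_deg i;
  emb_act : forall g i, yd_act g (f i) = mext (fun j => << f j >>) (yd_act g i)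
}.

Lemma embedding_comp S W X (f : yd_base S -> yd_base W) (g : yd_base W -> yd_base X) :
  embedding f -> embedding g -> embedding (g \o f).
Proof.
move=> ef eg; split=> [|i|h i] /=.
- exact: inj_comp (emb_inj eg) (emb_inj ef).
- by rewrite (emb_deg eg) (emb_deg ef).
rewrite (emb_act eg) (emb_act ef) mextK; apply: eq_mext => j /=.
by rewrite mextU.
Qed.

Lemma embedding_inl S W : @embedding S (ydsum S W) inl.
Proof. by split=> // i j []. Qed.

Lemma embedding_inr S W : @embedding S (ydsum W S) inr.
Proof. by split=> // i j []. Qed.

Section Transfer.
Context (S W : ydModule k gT) (f : yd_base S -> yd_base W) (ef : embedding f).

Definition inc : {malg k[yd_base S]} -> {malg k[yd_base W]} :=
  mext (fun j => << f j >>).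
HB.instance Definition _ := GRing.Linear.on inc.

Definition extend (F : yd_base S -> k) (b : yd_base W) : k :=
  if [pick i | f i == b] is Some i then F i else 0.

Definition image_pred : pred (yd_base W) := fun b => b \in codom f.

Lemma extendE F i : extend F (f i) = F i.
Proof.
rewrite /extend; case: pickP => [j /eqP /(emb_inj ef) -> //|/(_ i)].
by rewrite eqxx.
Qed.

Lemma inc_supp u b : (inc u)@_b != 0 -> exists2 i, b = f i & u@_i != 0.
Proof.
rewrite mcoeff_neq0 => /msupp_mext[i iu]; rewrite msuppU oner_eq0 inE => /eqP->.
by exists i; rewrite ?mcoeff_neq0.
Qed.

Lemma mact_inc h u : mact h (inc u) = inc (mact h u).
Proof.
rewrite /mact /inc !mextK; apply: eq_mext => i /=.
by rewrite mextU (emb_act ef).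
Qed.

Lemma pairing_extend F u : pairing (extend F) (inc u) = pairing F u.
Proof.
rewrite /pairing.
under eq_bigr => b _ do rewrite /inc mext_fin raddf_sum mulr_sumr.
rewrite exchange_big; apply: eq_bigr => i _ /=.
rewrite (bigD1 (f i)) //= mcoeffZ mcoeffU eqxx mulr1 extendE.
rewrite [X in _ + X]big1 ?addr0 // => b.
by rewrite mcoeffZ mcoeffU eq_sym => /negPf->; rewrite !mulr0.
Qed.

Lemma image_pred_stable : stable image_pred.
Proof.
move=> h b c /codomP[i ->]; rewrite (emb_act ef) => /msupp_mext[j _].
by rewrite msuppU oner_eq0 inE => /eqP->; apply: codom_f.
Qed.

Lemma extend_supp F b : extend F b != 0 -> exists2 i, b = f i & F i != 0.
Proof. by rewrite /extend; case: pickP => [i /eqP<- ?|]; [exists i | rewrite eqxx]. Qed.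

Lemma block_inc g0 g1 u0 u1 F0 F1 :
  block predT g0 g1 u0 u1 F0 F1 ->
  block image_pred g0 g1 (inc u0) (inc u1) (extend F0) (extend F1).
Proof.
move=> bl; have sup u : supported image_pred (inc u).
  by move=> b /inc_supp[i -> _]; apply: codom_f.
have supF F b : extend F b != 0 -> image_pred b.
  by move=> /extend_supp[i -> _]; apply: codom_f.
split=> //; rewrite ?pairing_extend.
- exact: image_pred_stable.
- by move=> b /inc_supp[i -> /(block_hom0 bl) <-]; apply: emb_deg.
- by move=> b /inc_supp[i -> /(block_hom1 bl) <-]; apply: emb_deg.
- exact: supF.
- exact: supF.
- by move=> b /extend_supp[i -> /(block_homF0 bl) <-]; apply: emb_deg.
- by move=> b /extend_supp[i -> /(block_homF1 bl) <-]; apply: emb_deg.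
- exact: block_00 bl.
- exact: block_01 bl.
- exact: block_10 bl.
exact: block_11 bl.
Qed.

Lemma central_table_inc x y u0 u1 :
  central_table x y u0 u1 -> central_table x y (inc u0) (inc u1).
Proof.
by case=> t1 t2 t3 t4; split; rewrite mact_inc ?t1 ?t2 ?t3 ?t4 ?linearN.
Qed.

Lemma rotation_table_inc x y u0 u1 :
  rotation_table x y u0 u1 -> rotation_table x y (inc u0) (inc u1).
Proof.
by case=> t1 t2 t3 t4; split; rewrite mact_inc ?t1 ?t2 ?t3 ?t4 ?linearN.
Qed.

Lemma reflection_table_inc x y e u0 u1 :
  reflection_table x y e u0 u1 -> reflection_table x y e (inc u0) (inc u1).
Proof.
by case=> t1 t2 t3 t4; split; rewrite mact_inc ?t1 ?t2 ?t3 ?t4 ?linearN ?linearZ.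
Qed.

End Transfer.
End Embedding.

(** * Two-dimensional modules: simplicity and isomorphism *)
Section Modules.
Context (k : fieldType) (gT : finGroupType).
Implicit Types V W : ydModule k gT.

Definition basis2 V g0 g1 (u0 u1 : {malg k[yd_base V]}) F0 F1 : Prop :=
  block predT g0 g1 u0 u1 F0 F1 /\
  forall u, u = pairing F0 u *: u0 + pairing F1 u *: u1.

Lemma block_neq0 V (P : pred (yd_base V)) g0 g1 u0 u1 F0 F1 :
  block P g0 g1 u0 u1 F0 F1 -> u0 <> 0 /\ u1 <> 0.
Proof.
have p0 F : pairing F (0 : {malg k[yd_base V]}) = 0.
  by rewrite /pairing big1 // => b _; rewrite mcoeff0 mulr0.
move=> bl; split=> u; [have := block_00 bl | have := block_11 bl].
  by rewrite u p0 => /eqP; rewrite eq_sym oner_eq0.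
by rewrite u p0 => /eqP; rewrite eq_sym oner_eq0.
Qed.

Lemma mact1 V (u : {malg k[yd_base V]}) : mact 1%g u = u.
Proof.
by rewrite -[RHS]mext_id; apply: eq_mext => i; apply: yd_act1.
Qed.

Lemma mactM V g h (u : {malg k[yd_base V]}) : mact (g * h)%g u = mact g (mact h u).
Proof. by rewrite /mact mextK; apply: eq_mext => i /=; apply: yd_actM. Qed.

Lemma mactN V h (u : {malg k[yd_base V]}) : mact h (- u) = - mact h u.
Proof. exact: linearN. Qed.

Lemma mactZ V h c (u : {malg k[yd_base V]}) : mact h (c *: u) = c *: mact h u.
Proof. exact: linearZ. Qed.

Lemma mcomponent_homog V g h (u : {malg k[yd_base V]}) : homog g u ->
  mcomponent (@yd_deg _ _ V) h u = if h == g then u else 0.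
Proof.
move=> hu; rewrite /mcomponent mext_fin.
have E b : u@_b *: (if yd_deg b == h then << b >> else 0) =
    (if h == g then u@_b *: << b >> else 0) :> {malg k[yd_base V]}.
  case: (eqVneq u@_b 0) => [->|/hu->]; first by rewrite !scale0r; case: ifP.
  by rewrite eq_sym; case: ifP => // _; rewrite scaler0.
rewrite (eq_bigr _ (fun b _ => E b)); case: ifP => _; last by rewrite big1.
by rewrite -malg_fin.
Qed.

Lemma basis2_letters V (e0 e1 : yd_base V) (c : k) : e0 != e1 ->
  (forall b, (b == e0) || (b == e1)) -> c != 0 ->
  basis2 (yd_deg e0) (yd_deg e1) << e0 >> (c *: << e1 >>)
    (fun b => (b == e0)%:R) (fun b => (b == e1)%:R / c).
Proof.
move=> e01 allb c0; have e10 := e01; rewrite eq_sym in e10.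
have pair F u : pairing F u = F e0 * u@_e0 + F e1 * u@_e1 :> k.
  rewrite /pairing (bigD1 e0) //= (bigD1 e1) //= big1 ?addr0 // => b /andP[b0 b1].
  by have := allb b; rewrite (negPf b0) (negPf b1).
have U_coef (a b : yd_base V) : (<< a >> : {malg k[yd_base V]})@_b = (a == b)%:R.
  by rewrite mcoeffU.
have c1 b : (c *: << e1 >> : {malg k[yd_base V]})@_b = c * (e1 == b)%:R.
  by rewrite mcoeffZ U_coef.
split; first split.
- by [].
- by [].
- by [].
- move=> b; rewrite U_coef; case: (eqVneq e0 b) => [<- //|_]; by rewrite eqxx.
- move=> b; rewrite c1; case: (eqVneq e1 b) => [<- //|_]; by rewrite mulr0 eqxx.
- by [].
- by [].
- move=> b; case: (eqVneq b e0) => [-> //|_]; by rewrite eqxx.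
- move=> b; case: (eqVneq b e1) => [-> //|_]; by rewrite mul0r eqxx.
- by rewrite pair !U_coef !eqxx (negPf e01) mulr0 addr0 mulr1.
- by rewrite pair !c1 !eqxx (negPf e10) !(mulr0, mul0r) addr0.
- by rewrite pair !U_coef !eqxx (negPf e01) !(mulr0, mul0r) addr0.
- by rewrite pair !c1 !eqxx (negPf e10) !(mulr0, mul0r) add0r mulr1 mul1r mulVf.
move=> u; rewrite !pair !eqxx (negPf e01) (negPf e10) !mul0r addr0 add0r !mul1r.
rewrite scalerA mulrAC mulVf // mul1r; apply/malgP => b.
rewrite mcoeffD !mcoeffZ !U_coef; have /orP[] := allb b => /eqP->.
  by rewrite eqxx (negPf e10) mulr0 addr0 mulr1.
by rewrite eqxx (negPf e01) mulr0 add0r mulr1.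
Qed.

Lemma basis2_vectors V (e0 e1 : yd_base V) g (p q p' q' : k) : e0 != e1 ->
  (forall b, (b == e0) || (b == e1)) -> yd_deg e0 = g -> yd_deg e1 = g ->
  p * q' - q * p' != 0 ->
  exists F0 F1, basis2 g g (p *: << e0 >> + q *: << e1 >>)
                           (p' *: << e0 >> + q' *: << e1 >>) F0 F1.
Proof.
move=> e01 allb dg0 dg1; set d := p * q' - _ => d0.
have e10 := e01; rewrite eq_sym in e10.
have degg (b : yd_base V) : yd_deg b = g by have /orP[] := allb b => /eqP->.
have pair F u : pairing F u = F e0 * u@_e0 + F e1 * u@_e1 :> k.
  rewrite /pairing (bigD1 e0) //= (bigD1 e1) //= big1 ?addr0 // => b /andP[b0 b1].
  by have := allb b; rewrite (negPf b0) (negPf b1).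
have U_coef (a b : yd_base V) : (<< a >> : {malg k[yd_base V]})@_b = (a == b)%:R.
  by rewrite mcoeffU.
have c0 a b : (a *: << e0 >> + b *: << e1 >> : {malg k[yd_base V]})@_e0 = a.
  by rewrite mcoeffD !mcoeffZ !U_coef eqxx (negPf e10) mulr0 addr0 mulr1.
have c1 a b : (a *: << e0 >> + b *: << e1 >> : {malg k[yd_base V]})@_e1 = b.
  by rewrite mcoeffD !mcoeffZ !U_coef eqxx (negPf e01) mulr0 add0r mulr1.
exists (fun b => if b == e0 then q' / d else - p' / d),
       (fun b => if b == e0 then - q / d else p / d).
split; first split=> //; rewrite ?pair ?c0 ?c1 ?eqxx ?(negPf e10) /d.
- by field.
- by field.
- by field.
- by field.
move=> u; rewrite !pair !eqxx (negPf e10); apply/malgP => b.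
have [/eqP->|/eqP->] := orP (allb b).
  by rewrite mcoeffD !mcoeffZ !c0 /d; field.
by rewrite mcoeffD !mcoeffZ !c1 /d; field.
Qed.

Section Simple.
Context (V : ydModule k gT) (g0 g1 : gT) (u0 u1 : {malg k[yd_base V]})
  (F0 F1 : yd_base V -> k) (B : basis2 g0 g1 u0 u1 F0 F1).

(** A nonzero submodule contains a nonzero multiple of u0 or of u1 as soon as it can
    be split along this basis; r then carries one basis vector to the other.  The
    case distinction on an arbitrary submodule is classical. *)
Lemma basis2_simple (r : gT) :
  mact r u0 = u1 ->
  (exists c, mact r u1 = c *: u0 /\ c != 0) ->
  (forall U, yd_submodule U -> forall a b,
     U (a *: u0 + b *: u1) -> U (a *: u0) /\ U (b *: u1)) ->
  yd_simple V.
Proof.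
move=> ru0 [c [ru1 c0]] split_U; split; first by exists u0; case: (block_neq0 B.1).
move=> U sU; case: (classic (exists2 v, U v & v <> 0)) => [[v Uv v0]|nv]; last first.
  left=> v Uv; case: (classic (v = 0)) => // v0; case: nv; by exists v.
right; have [[U0 UL] Uact _] := sU.
have UZ a w : U w -> U (a *: w) by move=> Uw; rewrite -[_ *: _]addr0; apply: UL.
have unscale a w : a != 0 -> U (a *: w) -> U w.
  by move=> a0 /(UZ a^-1); rewrite scalerK.
have u01 : U u0 -> U u1 by move=> h; rewrite -ru0; apply: Uact.
have u10 : U u1 -> U u0.
  by move=> h; apply: (unscale _ _ c0); rewrite -ru1; apply: Uact.
suff Uu0 : U u0.
  move=> w; rewrite (B.2 w); apply: UL => //; apply: UZ; exact: u01.
have [] := split_U U sU (pairing F0 v) (pairing F1 v); first by rewrite -(B.2 v).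
case: (eqVneq (pairing F0 v) 0) => [p0|/unscale h /h //] _.
case: (eqVneq (pairing F1 v) 0) => [p1|/unscale h /h /u10 //].
by case: v0; rewrite (B.2 v) p0 p1 !scale0r addr0.
Qed.

(** Distinct degrees: the coaction splits a submodule. *)
Lemma basis2_simple_deg (r : gT) : g0 != g1 ->
  mact r u0 = u1 -> (exists c, mact r u1 = c *: u0 /\ c != 0) -> yd_simple V.
Proof.
move=> g01 ru0 ru1; apply: (basis2_simple ru0 ru1) => U [_ _ Ucomp] a b Uab.
have hom0 := mcomponent_homog _ (block_hom0 B.1).
have hom1 := mcomponent_homog _ (block_hom1 B.1).
have := Ucomp g0 _ Uab; have := Ucomp g1 _ Uab.
rewrite /mcomponent !linearP !linearZ /= -!/(mcomponent _ _ _) !hom0 !hom1 !eqxx.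
by rewrite (negPf g01) eq_sym (negPf g01) !scaler0 addr0 add0r.
Qed.

(** Equal degrees: the eigenspaces of t split a submodule. *)
Lemma basis2_simple_eigen (r t : gT) : 2%:R != 0 :> k ->
  mact r u0 = u1 -> (exists c, mact r u1 = c *: u0 /\ c != 0) ->
  mact t u0 = u0 -> mact t u1 = - u1 -> yd_simple V.
Proof.
move=> two0 ru0 ru1 tu0 tu1.
apply: (basis2_simple ru0 ru1) => U [[U0 UL] Uact _] a b Uab.
have Ut : U (a *: u0 - b *: u1).
  have := Uact t _ Uab; rewrite -/(mact t _) linearP linearZ /= tu0 tu1.
  by rewrite scalerN.
have UZ c w : U w -> U (c *: w) by move=> Uw; rewrite -[_ *: _]addr0; apply: UL.
have half w : U (w *+ 2) -> U w.
  by move=> /(UZ 2%:R^-1); rewrite -scaler_nat scalerK.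
split; apply: half.
  have := UL 1 _ _ Uab Ut; rewrite scale1r addrACA subrr addr0 -mulr2n //.
have := UL (-1) _ _ Ut Uab.
by rewrite scaleN1r opprB addrA subrK -mulr2n.
Qed.

Lemma not_isomorphic_deg W h0 h1 w0 w1 H0 H1 :
  @basis2 W h0 h1 w0 w1 H0 H1 -> g0 != h0 -> g0 != h1 -> ~ yd_isomorphic V W.
Proof.
move=> BW gh0 gh1 [f [bf _ fdeg]].
have := fdeg g0 u0; rewrite (mcomponent_homog _ (block_hom0 B.1)) eqxx.
rewrite [f u0 in RHS](BW.2 (f u0)) /mcomponent linearP linearZ /= -!/(mcomponent _ _ _).
rewrite (mcomponent_homog _ (block_hom0 BW.1)) (mcomponent_homog _ (block_hom1 BW.1)).
rewrite (negPf gh0) (negPf gh1) !scaler0 addr0 => fu0.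
have [n0 _] := block_neq0 B.1; apply: n0; apply: (bij_inj bf).
by rewrite fu0 linear0.
Qed.

Lemma not_isomorphic_eigen W (t : gT) (a b : k) :
  (forall u, mact (V := V) t u = a *: u) -> (forall u, mact (V := W) t u = b *: u) ->
  a != b -> ~ yd_isomorphic V W.
Proof.
move=> Va Wb ab [f [bf fact _]].
have := fact t u0; rewrite -![mext _ _]/(mact _ _) Va Wb linearZ /=.
move=> /eqP; rewrite -subr_eq0 -scalerBl scaler_eq0 subr_eq0 (negPf ab) /=.
have [n0 _] := block_neq0 B.1 => /eqP fu0; apply: n0; apply: (bij_inj bf).
by rewrite fu0 linear0.
Qed.

End Simple.
End Modules.

(** * Bases of the modules M(O, rho) *)
Section SimpleModules.
Context (k : fieldType) (gT : finGroupType) (s : gT).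

Fact class_base_subproof : s \in (s ^: [set: gT])%g.
Proof. exact: class_refl. Qed.

Definition class_base : class_type s := Sub s class_base_subproof.

(** The representative of the coset of s itself is the canonical element of a
    subgroup, that is 1. *)
Lemma class_rep_base : class_rep class_base = 1%g.
Proof.
rewrite /class_rep /repr ifT //.
by rewrite inE mul1g invg1 mulg1.
Qed.

Section Base.
Context (n : nat) (rho : mx_representation k 'C[s] n).

Lemma ydsimple_act_base h a : h \in 'C[s]%g ->
  mact (V := ydsimple rho) h << (class_base, a) >> =
  \sum_b rho h b a *: << (class_base, b) >>.
Proof.
move=> hs; rewrite /mact mextU /= /simple_act /=.
have ct : class_conj h class_base = class_base.
  by apply: val_inj => /=; move/cent1P: hs => ->; rewrite mulgK.
by rewrite /class_cocycle ct class_rep_base invg1 mul1g mulg1.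
Qed.

End Base.

Lemma card_two (T : finType) (a b : T) :
  a != b -> (forall c, (c == a) || (c == b)) -> #|T| = 2.
Proof.
move=> ab allc; rewrite (eq_card (B := pred2 a b)) ?card2 ?ab // => c.
by rewrite !inE allc.
Qed.

Section OneDim.
Context (rho : mx_representation k 'C[s] 1) (s' r : gT).
Context (def_s' : (r * s * r^-1 = s')%g) (ss' : s != s').
Context (class_s : (s ^: [set: gT] \subset [set s; s'])%g).

Local Notation V := (ydsimple rho).

(** When the class of s is {s, r s r^-1}, the vector over s and its translate by r
    form a basis. *)
Lemma ydsimple1_basis : exists v0 v1 F0 F1,
  [/\ @basis2 k gT V s s' v0 v1 F0 F1, mact r v0 = v1, yd_dim V = 2 &
      forall h, h \in 'C[s]%g -> mact h v0 = rho h 0 0 *: v0].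
Proof.
pose t1 := class_conj r class_base.
pose e0 : yd_base V := (class_base, 0); pose e1 : yd_base V := (t1, 0).
pose c := rho (class_cocycle r class_base) 0 0.
have v1E : mact (V := V) r << e0 >> = c *: << e1 >>.
  by rewrite /mact mextU /= /simple_act big_ord1.
have e01 : e0 != e1.
  by apply: contra ss' => /eqP[]; rewrite def_s' => <-.
have allb (b : yd_base V) : (b == e0) || (b == e1).
  case: b => t a; rewrite (ord1 a) !xpair_eqE !eqxx !andbT -!val_eqE /= def_s'.
  by have := subsetP class_s _ (valP t); rewrite !inE.
have c0 : c != 0.
  apply/eqP => c0; move: (congr1 (mact r^-1%g) v1E).
  rewrite c0 scale0r linear0 -mactM mulVg mact1 => /(congr1 (mcoeff e0)).
  by rewrite mcoeffU eqxx mcoeff0 => /eqP; rewrite oner_eq0.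
exists << e0 >>, (mact r << e0 >>), (fun b => (b == e0)%:R),
  (fun b => (b == e1)%:R / c).
split; [|exact: erefl|exact: card_two e01 allb|].
  rewrite v1E; have := basis2_letters e01 allb c0.
  by rewrite [yd_deg e1]def_s'.
move=> h hs; have H := ydsimple_act_base rho 0 hs.
by rewrite big_ord1 in H.
Qed.
End OneDim.
End SimpleModules.

Section Central.
Context (k : fieldType) (gT : finGroupType) (two0 : 2%:R != 0 :> k).
Context (x y : gT) (hy : (y ^+ 2 = 1)%g) (hx : (x ^+ 4 = 1)%g)
  (hyxy : (y * x * y = x^-1)%g) (hgen : <<[set x; y]>>%g = [set: gT]%g).

Lemma commute_x2 g : commute g (x ^+ 2)%g.
Proof.
have cx : x \in 'C[(x ^+ 2)%g]%g by apply/cent1P/commuteX.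
have cy : y \in 'C[(x ^+ 2)%g]%g.
  by apply/cent1P; rewrite /commute; dihedral hy hx hyxy.
apply/cent1P; have : g \in <<[set x; y]>>%g by rewrite hgen inE.
by apply/subsetP; rewrite gen_subG; apply/subsetP => h /set2P[]->.
Qed.

Lemma in_cent_x2 g : g \in 'C[(x ^+ 2)%g]%g.
Proof. exact/cent1P/commute_x2. Qed.

Section Irreducible.
Context (rho : mx_representation k 'C[(x ^+ 2)%g] 2) (irr : mx_irreducible rho).

Local Notation X := (rho x).
Local Notation Y := (rho y).

Lemma rhoM g h : rho (g * h)%g = rho g * rho h.
Proof. by rewrite repr_mxM ?in_cent_x2. Qed.

(** Schur's lemma; it is enough to commute with the two generators. *)
Lemma commuting_zero_or_unit (f : 'M[k]_2) : f * X = X * f -> f * Y = Y * f ->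
  f = 0 \/ f \in unitmx.
Proof.
move=> fX fY; case: (eqVneq f 0) => [->|f0]; [by left | right].
apply: (mx_Schur irr) => //; apply: (@subset_trans _ _ <<[set x; y]>>%g).
  by rewrite hgen subsetT.
rewrite gen_subG; apply/subsetP => h /set2P[]->; by rewrite inE in_cent_x2; apply/eqP.
Qed.

Lemma unitmx_cancel (f g : 'M[k]_2) : f \in unitmx -> g * f = 0 -> g = 0.
Proof. by move=> uf gf; rewrite -[g](mulmxK uf) [g *m f]gf mul0mx. Qed.

(** If X^2 + 1 is invertible then X^2 = 1, so X and Y commute; each of them commutes
    with the whole image and squares to 1, hence is 1 or -1.  But then the rank-one
    matrix delta_mx 0 0 also commutes with the image, against Schur's lemma. *)
Lemma repr_x2 : X * X = -1.
Proof.
have XX : X * X * (X * X) = 1.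
  rewrite -!rhoM (_ : x * x * (x * x) = 1)%g ?repr_mx1 //.
  by rewrite -hx !expgS !mulgA mulg1.
have YY : Y * Y = 1 by rewrite -rhoM [(y * y)%g]hy repr_mx1.
have YX : Y * X = X * X * X * Y.
  by rewrite -!rhoM; congr (rho _); dihedral hy hx hyxy.
have [|//|X2|u] := @commuting_zero_or_unit (X * X + 1).
- by rewrite mulrDl mulrDr mul1r mulr1 mulrA.
- rewrite mulrDl mulrDr mul1r mulr1 mulrA YX -[_ * Y * X]mulrA YX !mulrA; congr (_ + _).
  by rewrite -[X * X * X * X]mulrA XX mul1r.
- by apply/eqP; rewrite -addr_eq0 X2.
have X2 : X * X = 1.
  apply/eqP; rewrite -subr_eq0; apply/eqP/(unitmx_cancel u).
  by rewrite mulrDr mulr1 mulrBl mul1r XX addrC addrA subrK subrr.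
have YXC : X * Y = Y * X by rewrite YX X2 mul1r.
have pm (Z : 'M[k]_2) : Z * Z = 1 -> Z * X = X * Z -> Z * Y = Y * Z -> Z = 1 \/ Z = -1.
  move=> ZZ ZX ZY; have [||Z1|uZ] := @commuting_zero_or_unit (Z - 1).
  - by rewrite mulrBl mulrBr mul1r mulr1 ZX.
  - by rewrite mulrBl mulrBr mul1r mulr1 ZY.
  - by left; apply/eqP; rewrite -subr_eq0 Z1.
  right; apply/eqP; rewrite -addr_eq0; apply/eqP/(unitmx_cancel uZ).
  by rewrite mulrDl mul1r mulrBr mulr1 ZZ addrA subrK subrr.
have commE (Z f : 'M[k]_2) : Z = 1 \/ Z = -1 -> f * Z = Z * f.
  by case=> ->; rewrite ?mulr1 ?mul1r // mulrN1 mulN1r.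
have [||d0|ud] := @commuting_zero_or_unit (delta_mx 0 0).
- exact/commE/pm.
- by apply/commE/pm.
- by move/matrixP/(_ 0 0): d0; rewrite !mxE !eqxx => /eqP; rewrite oner_eq0.
have := mxrank_unit ud; rewrite mxrank_delta //.
Qed.

(** V has a basis e indexed by 'I_2 in the single degree g, on which the group acts by
    the matrices of rho. *)
Section Columns.
Context (V : ydModule k gT) (e : 'I_2 -> yd_base V) (g : gT).
Context (deg_e : forall a, yd_deg (e a) = g) (e01 : e 0 != e 1)
  (e_all : forall b, (b == e 0) || (b == e 1))
  (act_e : forall h a, mact h << e a >> = \sum_b rho h b a *: << e b >>).

Definition col_vec (c : 'cV[k]_2) : {malg k[yd_base V]} :=
  \sum_a c a 0 *: << e a >>.

Lemma mact_col_vec h c : mact h (col_vec c) = col_vec (rho h *m c).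
Proof.
rewrite /col_vec linear_sum.
under eq_bigr => a _ do rewrite linearZ /= act_e scaler_sumr.
rewrite exchange_big; apply: eq_bigr => b _ /=.
rewrite mxE scaler_suml; apply: eq_bigr => a _.
by rewrite scalerA mulrC.
Qed.

Lemma col_vecN c : col_vec (- c) = - col_vec c.
Proof. by rewrite /col_vec -sumrN; apply: eq_bigr => a _; rewrite mxE scaleNr. Qed.

(** Take a column c fixed by Y, for example a nonzero column of 1 + Y, which exists
    because Y = -1 would commute with X.  As Y anticommutes with X, the column X c is
    negated by Y, so c and X c are independent. *)
Lemma central_module_basis : exists (u0 u1 : {malg k[yd_base V]}) F0 F1,
  basis2 g g u0 u1 F0 F1 /\ central_table x y u0 u1.
Proof.
have XX := repr_x2.
have YY : Y * Y = 1 by rewrite -rhoM [(y * y)%g]hy repr_mx1.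
have YX : Y * X = - (X * Y).
  rewrite -rhoM (_ : y * x = x * (x * (x * y)))%g; last by dihedral hy hx hyxy.
  by rewrite !rhoM !mulrA XX !mulN1r mulNr.
have [j cj0] : exists j, col j (1 + Y) != 0.
  apply/existsP; apply: contraT; rewrite negb_exists => /forallP Y1.
  have Y0 : 1 + Y = 0.
    apply/matrixP => i j; have := Y1 j; rewrite negbK => /eqP/matrixP/(_ i 0).
    by rewrite !mxE.
  have YN : Y = -1 by apply/eqP; rewrite -addr_eq0 addrC Y0.
  have /eqP : X *+ 2 = 0.
    have := YX; rewrite YN mulN1r mulrN1 opprK => /eqP.
    by rewrite eq_sym -addr_eq0 => /eqP.
  rewrite -scaler_nat scaler_eq0 (negPf two0) /= => /eqP X0.
  have := XX; rewrite X0 mul0r => /matrixP/(_ 0 0)/eqP.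
  by rewrite !mxE eq_sym oppr_eq0 oner_eq0.
pose c := col j (1 + Y); pose c' := X *m c.
have Yc : Y *m c = c.
  by rewrite /c colE mulmxA [Y *m _]mulrDr mulr1 YY addrC.
have Xc' : X *m c' = - c by rewrite mulmxA [X *m X]XX mulNmx mul1mx.
have Yc' : Y *m c' = - c' by rewrite mulmxA [Y *m X]YX mulNmx -mulmxA Yc.
have Xc : X *m c = c' by [].
have {}cj0 : c != 0 by [].
clearbody c'; clearbody c.
have vecE (v : 'cV[k]_2) : col_vec v = v 0 0 *: << e 0 >> + v 1 0 *: << e 1 >>.
  by rewrite /col_vec big_ord_recl big_ord1 (_ : lift ord0 ord0 = 1) //; apply: val_inj.
have colP (v w : 'cV[k]_2) : v 0 0 = w 0 0 -> v 1 0 = w 1 0 -> v = w.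
  move=> h0 h1; apply/matrixP => i l; rewrite (ord1 l).
  by case: i => [[|[|//]] hi];
    [rewrite (_ : Ordinal hi = 0) | rewrite (_ : Ordinal hi = 1)];
    rewrite ?h0 ?h1 //; apply: val_inj.
have c'0 : c' != 0.
  apply: contra cj0 => /eqP c'0; have := Xc'; rewrite c'0 mulmx0 => /eqP.
  by rewrite eq_sym oppr_eq0.
have free a b : a *: c + b *: c' = 0 -> a = 0 /\ b = 0.
  move=> ab; have := congr1 (mulmx Y) ab.
  rewrite mulmx0 mulmxDr -!scalemxAr Yc Yc' => ab'.
  have ea : (2%:R * a) *: c = 0.
    have -> : (2%:R * a) *: c = (a *: c + b *: c') + (a *: c + b *: - c').
      by rewrite mulr_natl mulr2n scalerDl scalerN addrACA subrr addr0.
    by rewrite ab ab' addr0.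
  have a0 : a = 0.
    by move/eqP: ea; rewrite scaler_eq0 (negPf cj0) orbF mulf_eq0 (negPf two0) => /eqP.
  split=> //; move/eqP: ab.
  by rewrite a0 scale0r add0r scaler_eq0 (negPf c'0) orbF => /eqP.
have det0 : c 0 0 * c' 1 0 - c 1 0 * c' 0 0 != 0.
  apply: contra cj0 => /eqP d0.
  have [c1 c2] : c' 1 0 = 0 /\ - c 1 0 = 0.
    by apply: free; apply: colP; rewrite !mxE; [rewrite -[RHS]d0|]; ring.
  have [c3 c4] : c' 0 0 = 0 /\ - c 0 0 = 0.
    by apply: free; apply: colP; rewrite !mxE; [|rewrite -[RHS]oppr0 -d0]; ring.
  apply/eqP/colP; rewrite [RHS]mxE; apply/eqP; rewrite -oppr_eq0; exact/eqP.
have [F0 [F1 B]] := basis2_vectors e01 e_all (deg_e 0) (deg_e 1) det0.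
exists (col_vec c), (col_vec c'), F0, F1; split; first by rewrite !vecE.
by split; rewrite mact_col_vec ?Xc ?Xc' ?Yc ?Yc' ?col_vecN.
Qed.

End Columns.

End Irreducible.
End Central.

(** * The dihedral group of order 8 *)
Section Dihedral8.
Context (gT : finGroupType) (card8 : #|[set: gT]| = 8).
Context (x y : gT) (hy : (y ^+ 2 = 1)%g) (hx : (x ^+ 4 = 1)%g)
  (hyxy : (y * x * y = x^-1)%g) (hgen : <<[set x; y]>>%g = [set: gT]%g).

(** The group is the product of <x> and <y>, of orders at most 4 and 2, and has 8
    elements. *)
Lemma dihedral8_orders : [/\ #[x]%g = 4, #[y]%g = 2 & (<[x]> :&: <[y]> = 1)%g].
Proof.
have nxy : (<[y]> \subset 'N(<[x]>))%g.
  rewrite cycle_subG inE -cycleJ cycle_subG.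
  have -> : (x ^ y = x^-1)%g.
    rewrite conjgE -hyxy -!mulgA; congr (_ * _)%g.
    by apply/eqP; rewrite eq_invg_mul -[(y * y)%g]/(y ^+ 2)%g hy.
  by rewrite groupV cycle_id.
have xyT : (<[x]> * <[y]> = [set: gT])%g.
  rewrite -norm_joinEr //; apply/eqP; rewrite eqEsubset subsetT -hgen gen_subG.
  by apply/subsetP => h /set2P[]->; rewrite mem_gen // inE cycle_id ?orbT.
have ox : (#[x]%g <= 4)%N by apply: dvdn_leq => //; rewrite order_dvdn hx.
have oy : (#[y]%g <= 2)%N by apply: dvdn_leq => //; rewrite order_dvdn hy.
have := mul_cardG <[x]>%G <[y]>%G; rewrite /= xyT card8 -!orderE.
have m0 : (0 < #|(<[x]> :&: <[y]>)%g|)%N by apply: cardG_gt0.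
move=> e.
have m1 : #|(<[x]> :&: <[y]>)%g| = 1.
  apply/eqP; rewrite eqn_leq m0 andbT -(@leq_pmul2l 8) // -e.
  exact: (leq_mul ox oy).
rewrite m1 muln1 in e.
split; last exact/card1_trivg.
  apply/eqP; rewrite eqn_leq ox /= -(@leq_pmul2r 2) // -[(4 * 2)%N]e.
  by rewrite leq_pmul2l ?order_gt0.
apply/eqP; rewrite eqn_leq oy /= -(@leq_pmul2l 4) // -[(4 * 2)%N]e.
by rewrite leq_pmul2r ?order_gt0.
Qed.

Lemma expx_neq i j : (i < 4)%N -> (j < 4)%N -> i != j -> (x ^+ i != x ^+ j)%g.
Proof.
move=> hi hj ij; have [o _ _] := dihedral8_orders.
by rewrite eq_expg_mod_order o !modn_small.
Qed.

Lemma expx_neq_y i j : (x ^+ i != x ^+ j * y)%g.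
Proof.
apply/eqP => e; have [_ o t] := dihedral8_orders.
have : y \in (<[x]> :&: <[y]>)%g.
  rewrite inE cycle_id andbT.
  by rewrite -[y](mulKg (x ^+ j)%g) -e groupM ?groupV ?mem_cycle.
by rewrite t => /set1gP y1; rewrite y1 order1 in o.
Qed.

Lemma expx_y_neq i j : (i < 4)%N -> (j < 4)%N -> i != j ->
  (x ^+ i * y != x ^+ j * y)%g.
Proof. by move=> hi hj ij; rewrite (inj_eq (mulIg y)) expx_neq. Qed.

(** The hypotheses say that x and y normalise the pair. *)
Lemma class_sub_pair s s' :
  (x * s * x^-1)%g \in [set s; s'] -> (x * s' * x^-1)%g \in [set s; s'] ->
  (y * s * y^-1)%g \in [set s; s'] -> (y * s' * y^-1)%g \in [set s; s'] ->
  (s ^: [set: gT] \subset [set s; s'])%g.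
Proof.
move=> xs xs' ys ys'; rewrite class_sub_norm ?inE ?eqxx //.
apply: (@subset_trans _ _ <<[set x; y]>>%g); first by rewrite hgen subsetT.
rewrite gen_subG; apply/subsetP => g /set2P[]->; rewrite -groupV inE;
  apply/subsetP => _ /imsetP[t /set2P[]-> ->]; by rewrite conjgE invgK mulgA.
Qed.

Section Modules8.
Context (k : fieldType) (two0 : 2%:R != 0 :> k).

Lemma reflection_table_intro (V : ydModule k gT) (u0 u1 : {malg k[yd_base V]}) e :
  mact x u0 = u1 -> mact y u0 = - u0 -> mact (x ^+ 2)%g u0 = e *: u0 ->
  reflection_table x y e u0 u1.
Proof.
move=> xu0 yu0 x2u0.
have xxu0 : mact x (mact x u0) = e *: u0 by rewrite -mactM.
split=> //; first by rewrite -xu0.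
rewrite -xu0 -mactM (_ : y * x = x * (x * (x * y)))%g; last by dihedral hy hx hyxy.
by rewrite !mactM yu0 !mactN xxu0 mactZ.
Qed.

Lemma rotation_table_intro (V : ydModule k gT) (u0 u1 : {malg k[yd_base V]}) :
  mact y u0 = u1 -> mact x u0 = - u0 -> rotation_table x y u0 u1.
Proof.
move=> yu0 xu0.
split=> //; last by rewrite -yu0 -mactM -[(y * y)%g]/(y ^+ 2)%g hy mact1.
rewrite -yu0 -mactM (_ : x * y = y * (x * (x * x)))%g; last by dihedral hy hx hyxy.
by rewrite !mactM !(xu0, mactN) opprK.
Qed.

Lemma reflection_module (rho : mx_representation k 'C[y] 1) e :
  rho y = (-1)%:M -> rho (x ^+ 2)%g = e%:M ->
  yd_dim (ydsimple rho) = 2 /\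
  exists (u0 u1 : {malg k[yd_base (ydsimple rho)]}) F0 F1,
    basis2 y (x ^+ 2 * y)%g u0 u1 F0 F1 /\ reflection_table x y e u0 u1.
Proof.
move=> rhoy rhox2.
have xyx : (x * y * x^-1 = x ^+ 2 * y)%g by dihedral hy hx hyxy.
have ss' : y != (x ^+ 2 * y)%g by rewrite -{1}[y]mul1g (@expx_y_neq 0 2).
have cl : (y ^: [set: gT] \subset [set y; x ^+ 2 * y])%g.
  apply: class_sub_pair; rewrite !inE ?xyx ?eqxx ?orbT //.
  - by apply/orP; left; apply/eqP; dihedral hy hx hyxy.
  - by rewrite mulgK eqxx.
  - by apply/orP; right; apply/eqP; dihedral hy hx hyxy.
have [u0 [u1 [F0 [F1 [B xu0 dim cent]]]]] := ydsimple1_basis rho xyx ss' cl.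
split; [exact: dim | exists u0, u1, F0, F1; split; first exact: B].
apply: reflection_table_intro xu0 _ _.
  by have := cent y (cent1id y); rewrite rhoy mxE eqxx mulr1n scaleN1r.
have x2c : (x ^+ 2)%g \in 'C[y]%g.
  by rewrite -cent1C; apply/cent1P/(commute_x2 hy hx hyxy hgen).
by have := cent _ x2c; rewrite rhox2 mxE eqxx mulr1n.
Qed.

Lemma rotation_module (rho : mx_representation k 'C[x] 1) :
  rho x = (-1)%:M ->
  yd_dim (ydsimple rho) = 2 /\
  exists (u0 u1 : {malg k[yd_base (ydsimple rho)]}) F0 F1,
    basis2 x x^-1%g u0 u1 F0 F1 /\ rotation_table x y u0 u1.
Proof.
move=> rhox.
have yxy : (y * x * y^-1 = x^-1)%g by dihedral hy hx hyxy.
have ss' : x != x^-1%g.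
  have := @expx_neq 1 3 isT isT isT; rewrite expg1 (_ : x ^+ 3 = x^-1)%g //.
  by dihedral hy hx hyxy.
have cl : (x ^: [set: gT] \subset [set x; x^-1])%g.
  apply: class_sub_pair; rewrite !inE ?yxy ?mulgK ?eqxx ?orbT //.
  - by rewrite mulgV mul1g eqxx orbT.
  - by apply/orP; left; apply/eqP; dihedral hy hx hyxy.
have [u0 [u1 [F0 [F1 [B yu0 dim cent]]]]] := ydsimple1_basis rho yxy ss' cl.
split; [exact: dim | exists u0, u1, F0, F1; split; first exact: B].
apply: rotation_table_intro yu0 _.
by have := cent x (cent1id x); rewrite rhox mxE eqxx mulr1n scaleN1r.
Qed.

Lemma central_module (rho : mx_representation k 'C[(x ^+ 2)%g] 2) :
  mx_irreducible rho ->
  yd_dim (ydsimple rho) = 2 /\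
  exists (u0 u1 : {malg k[yd_base (ydsimple rho)]}) F0 F1,
    basis2 (x ^+ 2)%g (x ^+ 2)%g u0 u1 F0 F1 /\ central_table x y u0 u1.
Proof.
move=> irr; pose e a : yd_base (ydsimple rho) := (class_base (x ^+ 2)%g, a).
have e01 : e 0 != e 1 by apply/eqP => /(congr1 (fun p => val p.2)).
have e_all b : (b == e 0) || (b == e 1).
  case: b => t a; rewrite !xpair_eqE.
  have -> : t == class_base (x ^+ 2)%g.
    rewrite -val_eqE /=; have /imsetP[g _ ->] := valP t.
    by rewrite conjgE -(commute_x2 hy hx hyxy hgen) mulKg.
  by case: a => [[|[|//]] ha]; rewrite -!val_eqE.
split; first exact: card_two e01 e_all.
apply: (central_module_basis two0 hy hx hyxy hgen irr (e := e)) => //.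
by move=> h a; apply/ydsimple_act_base/(in_cent_x2 hy hx hyxy hgen).
Qed.

End Modules8.
End Dihedral8.

(** * The three types of modules and their triples *)
Section SixTypes.
Context (k : fieldType) (gT : finGroupType).
Implicit Types V W : ydModule k gT.

Definition central_type (x y : gT) V : Prop :=
  exists (u0 u1 : {malg k[yd_base V]}) F0 F1,
    basis2 (x ^+ 2)%g (x ^+ 2)%g u0 u1 F0 F1 /\ central_table x y u0 u1.

Definition rotation_type (x y : gT) V : Prop :=
  exists (u0 u1 : {malg k[yd_base V]}) F0 F1,
    basis2 x x^-1%g u0 u1 F0 F1 /\ rotation_table x y u0 u1.

Definition reflection_type (x y : gT) e V : Prop :=
  exists (u0 u1 : {malg k[yd_base V]}) F0 F1,
    basis2 y (x ^+ 2 * y)%g u0 u1 F0 F1 /\ reflection_table x y e u0 u1.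

Context (char0 : [pchar k] =i pred0) (im : k) (im2 : im * im = -1).

(** The lemmas on blocks, read in the Nichols algebra of a module W with two or three
    prescribed summands. *)
Section Cases.
Context (x y : gT) (hy : (y ^+ 2 = 1)%g) (hx : (x ^+ 4 = 1)%g)
  (hyxy : (y * x * y = x^-1)%g).
Context (S1 S2 S3 W : ydModule k gT) (f1 : yd_base S1 -> yd_base W)
  (f2 : yd_base S2 -> yd_base W) (f3 : yd_base S3 -> yd_base W)
  (ef1 : embedding f1) (ef2 : embedding f2) (ef3 : embedding f3)
  (d12 : disj (image_pred f1) (image_pred f2))
  (d13 : disj (image_pred f1) (image_pred f3))
  (d23 : disj (image_pred f2) (image_pred f3)).

Lemma nichols_opposite_reflections e : e * e = 1 ->
  reflection_type x y e S1 -> reflection_type x (x * y)%g (- e) S2 ->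
  ~ nichols_finite_dim W.
Proof.
move=> ee [a0 [a1 [A0 [A1 [[bA _] tA]]]]] [b0 [b1 [B0 [B1 [[bB _] tB]]]]].
exact: (opposite_reflections_infinite (A := tensorBraided W) char0 hy hx hyxy im2 ee
  (block_inc ef1 bA) (reflection_table_inc ef1 tA) (block_inc ef2 bB)
  (reflection_table_inc ef2 tB) d12).
Qed.

Lemma nichols_central_rotation :
  central_type x y S1 -> rotation_type x y S2 -> ~ nichols_finite_dim W.
Proof.
move=> [a0 [a1 [A0 [A1 [[bA _] tA]]]]] [b0 [b1 [B0 [B1 [[bB _] tB]]]]].
exact: (central_rotation_pair_infinite (A := tensorBraided W) char0 hy hx hyxy im2
  (block_inc ef1 bA) (central_table_inc ef1 tA) (block_inc ef2 bB)
  (rotation_table_inc ef2 tB) d12).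
Qed.

Lemma nichols_central_reflections e : e * e = 1 ->
  central_type x y S1 -> reflection_type x y e S2 ->
  reflection_type x (x * y)%g e S3 ->
  ~ nichols_finite_dim W.
Proof.
move=> ee [a0 [a1 [A0 [A1 [[bA _] tA]]]]] [b0 [b1 [B0 [B1 [[bB _] tB]]]]].
move=> [c0 [c1 [C0 [C1 [[bC _] tC]]]]].
exact: (central_reflections_infinite (A := tensorBraided W) char0 hy hx hyxy im2 ee
  (block_inc ef1 bA) (central_table_inc ef1 tA) (block_inc ef2 bB)
  (reflection_table_inc ef2 tB) (block_inc ef3 bC) (reflection_table_inc ef3 tC)
  d12 d13 d23).
Qed.

Lemma nichols_rotation_reflections :
  rotation_type x y S1 -> reflection_type x y (-1) S2 -> reflection_type x y 1 S3 ->
  ~ nichols_finite_dim W.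
Proof.
move=> [a0 [a1 [A0 [A1 [[bA _] tA]]]]] [b0 [b1 [B0 [B1 [[bB _] tB]]]]].
move=> [c0 [c1 [C0 [C1 [[bC _] tC]]]]].
exact: (rotation_reflections_infinite (A := tensorBraided W) char0 hy hx hyxy im2
  (block_inc ef1 bA) (rotation_table_inc ef1 tA) (block_inc ef2 bB)
  (reflection_table_inc ef2 tB) (block_inc ef3 bC) (reflection_table_inc ef3 tC)
  d12 d13 d23).
Qed.

Lemma nichols_triangle_central :
  central_type x y S1 -> reflection_type x y (-1) S2 -> reflection_type x y 1 S3 ->
  ~ nichols_finite_dim W.
Proof.
move=> [a0 [a1 [A0 [A1 [[bA _] tA]]]]] [b0 [b1 [B0 [B1 [[bB _] tB]]]]].
move=> [c0 [c1 [C0 [C1 [[bC _] tC]]]]].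
exact: (triangle_central_infinite (A := tensorBraided W) char0 hy hx hyxy
  (block_inc ef1 bA) (central_table_inc ef1 tA) (block_inc ef2 bB)
  (reflection_table_inc ef2 tB) (block_inc ef3 bC) (reflection_table_inc ef3 tC)
  d12 d13 d23).
Qed.

Lemma nichols_triangle_outer e : e * e = 1 ->
  rotation_type x y S1 -> reflection_type x y e S2 ->
  reflection_type x (x * y)%g e S3 ->
  ~ nichols_finite_dim W.
Proof.
move=> ee [a0 [a1 [A0 [A1 [[bA _] tA]]]]] [b0 [b1 [B0 [B1 [[bB _] tB]]]]].
move=> [c0 [c1 [C0 [C1 [[bC _] tC]]]]].
exact: (triangle_outer_infinite (A := tensorBraided W) char0 hy hx hyxy ee
  (block_inc ef1 bA) (rotation_table_inc ef1 tA) (block_inc ef2 bB)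
  (reflection_table_inc ef2 tB) (block_inc ef3 bC) (reflection_table_inc ef3 tC)
  d12 d13 d23).
Qed.

End Cases.

Section Summands.
Context (S1 S2 S3 : ydModule k gT).
Local Notation W := (ydsum (ydsum S1 S2) S3).

Definition summand1 (a : yd_base S1) : yd_base W := inl (inl a).
Definition summand2 (a : yd_base S2) : yd_base W := inl (inr a).
Definition summand3 (a : yd_base S3) : yd_base W := inr a.

Lemma summand1_emb : embedding summand1.
Proof.
exact: embedding_comp (embedding_inl S1 S2) (embedding_inl (ydsum S1 S2) S3).
Qed.

Lemma summand2_emb : embedding summand2.
Proof.
exact: embedding_comp (embedding_inr S2 S1) (embedding_inl (ydsum S1 S2) S3).
Qed.

Lemma summand3_emb : embedding summand3.
Proof. exact: embedding_inr S3 (ydsum S1 S2). Qed.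

End Summands.

Lemma disj_image S1 S2 W (f1 : yd_base S1 -> yd_base W) (f2 : yd_base S2 -> yd_base W) :
  (forall a b, f1 a <> f2 b) -> disj (image_pred f1) (image_pred f2).
Proof. by move=> f12 b /codomP[i ->]; apply/codomP=> -[j]; apply: f12. Qed.

Local Notation in1 := (summand1_emb _ _ _).
Local Notation in2 := (summand2_emb _ _ _).
Local Notation in3 := (summand3_emb _ _ _).
Local Notation apart := (disj_image _).

Context (x y : gT) (hy : (y ^+ 2 = 1)%g) (hx : (x ^+ 4 = 1)%g)
  (hyxy : (y * x * y = x^-1)%g).
Context (M : nat -> ydModule k gT).
Context (t0 : central_type x y (M 0)) (t0' : central_type x (x * y)%g (M 0))
  (t1 : rotation_type x y (M 1)) (t1' : rotation_type x (x * y)%g (M 1))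
  (t2 : reflection_type x y (-1) (M 2)) (t3 : reflection_type x y 1 (M 3))
  (t4 : reflection_type x (x * y)%g (-1) (M 4))
  (t5 : reflection_type x (x * y)%g 1 (M 5)).

(** The pairs of indices 0,1 and 2,5 and 3,4 settle every triple containing them.  The
    triples 0,4,5 and 1,4,5 are the triples 0,2,3 and 1,2,3 for the generators x and
    x y. *)
Lemma triples_infinite i j l : (i < j)%N -> (j < l)%N -> (l < 6)%N ->
  ~ nichols_finite_dim (ydsum (ydsum (M i) (M j)) (M l)).
Proof.
have e11 : 1 * 1 = 1 :> k by rewrite mulr1.
have eN1 : -1 * -1 = 1 :> k by rewrite mulrNN mulr1.
have t4' : reflection_type x (x * y)%g (- 1) (M 4) by [].
have t5' : reflection_type x (x * y)%g (- -1) (M 5) by rewrite opprK.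
have hz : ((x * y) ^+ 2 = 1)%g by dihedral hy hx hyxy.
have hzxz : ((x * y) * x * (x * y) = x^-1)%g by dihedral hy hx hyxy.
case: i => [|[|[|[|[|[|i]]]]]]; case: j => [|[|[|[|[|[|j]]]]]] //;
case: l => [|[|[|[|[|[|l]]]]]] // _ _ _.
- exact: (nichols_central_rotation hy hx hyxy in1 in2 apart t0 t1).
- exact: (nichols_central_rotation hy hx hyxy in1 in2 apart t0 t1).
- exact: (nichols_central_rotation hy hx hyxy in1 in2 apart t0 t1).
- exact: (nichols_central_rotation hy hx hyxy in1 in2 apart t0 t1).
- exact: (nichols_triangle_central hy hx hyxy in1 in2 in3 apart apart apart
           t0 t2 t3).
- exact: (nichols_central_reflections hy hx hyxy in1 in2 in3 apart apart apart
           eN1 t0 t2 t4).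
- exact: (nichols_opposite_reflections hy hx hyxy in2 in3 apart eN1 t2 t5').
- exact: (nichols_opposite_reflections hy hx hyxy in2 in3 apart e11 t3 t4').
- exact: (nichols_central_reflections hy hx hyxy in1 in2 in3 apart apart apart
           e11 t0 t3 t5).
- exact: (nichols_triangle_central hz hx hzxz in1 in2 in3 apart apart apart
           t0' t4 t5).
- exact: (nichols_rotation_reflections hy hx hyxy in1 in2 in3 apart apart apart
           t1 t2 t3).
- exact: (nichols_triangle_outer hy hx hyxy in1 in2 in3 apart apart apart
           eN1 t1 t2 t4).
- exact: (nichols_opposite_reflections hy hx hyxy in2 in3 apart eN1 t2 t5').
- exact: (nichols_opposite_reflections hy hx hyxy in2 in3 apart e11 t3 t4').
- exact: (nichols_triangle_outer hy hx hyxy in1 in2 in3 apart apart apart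
           e11 t1 t3 t5).
- exact: (nichols_rotation_reflections hz hx hzxz in1 in2 in3 apart apart apart
           t1' t4 t5).
- exact: (nichols_opposite_reflections hy hx hyxy in2 in3 apart e11 t3 t4').
- exact: (nichols_opposite_reflections hy hx hyxy in1 in3 apart eN1 t2 t5').
- exact: (nichols_opposite_reflections hy hx hyxy in1 in3 apart eN1 t2 t5').
- exact: (nichols_opposite_reflections hy hx hyxy in1 in2 apart e11 t3 t4').
Qed.

End SixTypes.

(** * The six modules *)
Section SixModules.
Context (k : fieldType) (two0 : 2%:R != 0 :> k) (gT : finGroupType).
Context (card8 : #|[set: gT]| = 8).
Context (x y : gT) (hy : (y ^+ 2 = 1)%g) (hx : (x ^+ 4 = 1)%g)
  (hyxy : (y * x * y = x^-1)%g) (hgen : <<[set x; y]>>%g = [set: gT]%g).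
Context (M : nat -> ydModule k gT).
Context (t0 : central_type x y (M 0)) (t1 : rotation_type x y (M 1))
  (t2 : reflection_type x y (-1) (M 2)) (t3 : reflection_type x y 1 (M 3))
  (t4 : reflection_type x (x * y)%g (-1) (M 4))
  (t5 : reflection_type x (x * y)%g 1 (M 5)).

Definition dihedral_elt (p : nat * bool) : gT := (x ^+ p.1 * y ^+ p.2)%g.

Lemma dihedral_elt_neq p q : (p.1 < 4)%N -> (q.1 < 4)%N -> p != q ->
  dihedral_elt p != dihedral_elt q.
Proof.
case: p q => [i a] [j b] /= hi hj; rewrite xpair_eqE negb_and /dihedral_elt /=.
case: a b => -[]; rewrite ?expg1 ?expg0 ?mulg1 ?orbF //= => ij.
- exact: (expx_y_neq card8 hy hx hyxy hgen hi hj ij).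
- rewrite eq_sym; exact: (expx_neq_y card8 hy hx hyxy hgen).
- exact: (expx_neq_y card8 hy hx hyxy hgen).
exact: (expx_neq card8 hy hx hyxy hgen hi hj ij).
Qed.

(** The degrees of the basis of the n-th module, as the exponents of x and y. *)
Definition degree0 (n : nat) : nat * bool :=
  (nth (0, false) [:: (2, false); (1, false); (0, true);
                      (0, true); (1, true); (1, true)] n)%N.
Definition degree1 (n : nat) : nat * bool :=
  (nth (0, false) [:: (2, false); (3, false); (2, true);
                      (2, true); (3, true); (3, true)] n)%N.

Lemma degree_lt n : ((degree0 n).1 < 4)%N * ((degree1 n).1 < 4)%N.
Proof. by rewrite /degree0 /degree1; case: n => [|[|[|[|[|[|[|n]]]]]]]. Qed.

Lemma module_basis n : (n < 6)%N ->
  exists (u0 u1 : {malg k[yd_base (M n)]}) F0 F1,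
    basis2 (dihedral_elt (degree0 n)) (dihedral_elt (degree1 n)) u0 u1 F0 F1.
Proof.
have xV : (x^-1 = x ^+ 3)%g by dihedral hy hx hyxy.
have xxy : (x ^+ 2 * (x * y) = x ^+ 3 * y)%g by dihedral hy hx hyxy.
have Dt a : dihedral_elt (a, true) = (x ^+ a * y)%g by [].
have Df a : dihedral_elt (a, false) = (x ^+ a)%g by rewrite /dihedral_elt mulg1.
case: n => [|[|[|[|[|[|//]]]]]] _;
  rewrite /degree0 /degree1 /= ?Dt ?Df ?expg0 ?mul1g -?xxy.
- by have [u0 [u1 [F0 [F1 [B _]]]]] := t0; exists u0, u1, F0, F1.
- by rewrite -xV; have [u0 [u1 [F0 [F1 [B _]]]]] := t1; exists u0, u1, F0, F1.
- by have [u0 [u1 [F0 [F1 [B _]]]]] := t2; exists u0, u1, F0, F1.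
- by have [u0 [u1 [F0 [F1 [B _]]]]] := t3; exists u0, u1, F0, F1.
- by have [u0 [u1 [F0 [F1 [B _]]]]] := t4; exists u0, u1, F0, F1.
by have [u0 [u1 [F0 [F1 [B _]]]]] := t5; exists u0, u1, F0, F1.
Qed.

Lemma reflection_type_x2 (s : gT) e (V : ydModule k gT) (u : {malg k[yd_base V]}) :
  reflection_type x s e V -> mact (x ^+ 2)%g u = e *: u.
Proof.
move=> [u0 [u1 [F0 [F1 [[_ full] [xu0 xu1 _ _]]]]]].
rewrite -[(x ^+ 2)%g]/(x * x)%g mactM (full u).
have mactD v w : mact x (v + w) = mact x v + mact x w by exact: linearD.
by rewrite !(mactD, mactZ) xu0 xu1 mactZ xu0 scalerDr !scalerA ![e * _]mulrC.
Qed.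

(** Modules with different supports are not isomorphic; the two reflection modules
    with the same support are separated by the action of x^2. *)
Lemma modules_not_isomorphic i j : (i < 6)%N -> (j < 6)%N -> i != j ->
  ~ yd_isomorphic (M i) (M j).
Proof.
move=> hi hj ij.
have [u0 [u1 [F0 [F1 Bi]]]] := module_basis hi.
have [w0 [w1 [H0 [H1 Bj]]]] := module_basis hj.
have one : 1 != -1 :> k by rewrite -addr_eq0 -mulr2n.
have eN := one; rewrite eq_sym in eN.
have [/andP[d0 d1]|] := boolP ((degree0 i != degree0 j) && (degree0 i != degree1 j)).
  by apply: (not_isomorphic_deg Bi Bj); apply: dihedral_elt_neq; rewrite ?degree_lt.
move: hi hj ij u0 u1 F0 F1 Bi {w0 w1 H0 H1 Bj}.
case: i => [|[|[|[|[|[|//]]]]]]; case: j => [|[|[|[|[|[|//]]]]]] //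
  _ _ _ u0 u1 F0 F1 B _.
- exact: (not_isomorphic_eigen B (fun u => reflection_type_x2 u t2)
           (fun u => reflection_type_x2 u t3) eN).
- exact: (not_isomorphic_eigen B (fun u => reflection_type_x2 u t3)
           (fun u => reflection_type_x2 u t2) one).
- exact: (not_isomorphic_eigen B (fun u => reflection_type_x2 u t4)
           (fun u => reflection_type_x2 u t5) eN).
exact: (not_isomorphic_eigen B (fun u => reflection_type_x2 u t5)
           (fun u => reflection_type_x2 u t4) one).
Qed.

Lemma central_type_simple (V : ydModule k gT) : central_type x y V -> yd_simple V.
Proof.
move=> [u0 [u1 [F0 [F1 [B [xu0 xu1 yu0 yu1]]]]]].
apply: (basis2_simple_eigen B two0 xu0 _ yu0 yu1).
by exists (-1); rewrite xu1 scaleN1r oppr_eq0 oner_eq0.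
Qed.

Lemma rotation_type_simple (V : ydModule k gT) : rotation_type x y V -> yd_simple V.
Proof.
move=> [u0 [u1 [F0 [F1 [B [_ _ yu0 yu1]]]]]].
have xV : (x^-1 = x ^+ 3)%g by dihedral hy hx hyxy.
apply: (basis2_simple_deg B _ yu0); last first.
  by exists 1; rewrite yu1 scale1r oner_eq0.
by rewrite xV; apply: (@expx_neq _ card8 x y hy hx hyxy hgen 1 3).
Qed.

Lemma reflection_type_simple e (V : ydModule k gT) :
  e != 0 -> reflection_type x y e V -> yd_simple V.
Proof.
move=> e0 [u0 [u1 [F0 [F1 [B [xu0 xu1 _ _]]]]]].
apply: (basis2_simple_deg B _ xu0); last by exists e.
by rewrite -{1}[y]mul1g; apply: (@expx_y_neq _ card8 x y hy hx hyxy hgen 0 2).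
Qed.

End SixModules.

Lemma prim4_sq (k : fieldType) (z : k) : 4.-primitive_root z -> z * z = -1.
Proof.
move=> pz; have z4 := prim_expr_order pz.
have : (z ^+ 2 - 1) * (z ^+ 2 + 1) = 0 by rewrite -subr_sqr expr1n -exprM z4 subrr.
move/eqP; rewrite mulf_eq0 subr_eq0 addr_eq0 => /orP[|/eqP <-]; last by rewrite expr2.
by rewrite -(prim_order_dvd pz).
Qed.

Theorem theorem5p7 (k : closedFieldType) (char0 : [pchar k] =i pred0)
    (x y : 'D_8)
    (hy : (y ^+ 2 = 1)%g) (hx : (x ^+ 4 = 1)%g) (hyxy : (y * x * y = x^-1)%g)
    (hgen : <<[set x; y]>>%g = [set: 'D_8]%g)
    (rho : mx_representation k 'C[(x ^+ 2)%g] 2) (rho_irr : mx_irreducible rho)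
    (chi : mx_representation k 'C[x] 1)
    (chi_x : 4.-primitive_root (chi x 0 0))
    (sgnsgn_y sgneps_y : mx_representation k 'C[y] 1)
    (sgnsgn_xy sgneps_xy : mx_representation k 'C[(x * y)%g] 1)
    (ss_y : sgnsgn_y y = (-1)%:M) (ss_yx2 : sgnsgn_y (x ^+ 2)%g = (-1)%:M)
    (se_y : sgneps_y y = (-1)%:M) (se_yx2 : sgneps_y (x ^+ 2)%g = 1%:M)
    (ss_xy : sgnsgn_xy (x * y)%g = (-1)%:M)
    (ss_xyx2 : sgnsgn_xy (x ^+ 2)%g = (-1)%:M)
    (se_xy : sgneps_xy (x * y)%g = (-1)%:M)
    (se_xyx2 : sgneps_xy (x ^+ 2)%g = 1%:M) :
  let M (i : 'I_6) : ydModule k 'D_8 :=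
    match nat_of_ord i with
    | 0 => ydsimple rho
    | 1 => ydsimple (sq_repr chi)
    | 2 => ydsimple sgnsgn_y
    | 3 => ydsimple sgneps_y
    | 4 => ydsimple sgnsgn_xy
    | _ => ydsimple sgneps_xy
    end%N in
  [/\ forall i, yd_simple (M i) /\ yd_dim (M i) = 2%N,
      forall i j, i != j -> ~ yd_isomorphic (M i) (M j) &
      forall i j l : 'I_6, (i < j)%N -> (j < l)%N ->
        ~ nichols_finite_dim (ydsum (ydsum (M i) (M j)) (M l))].
Proof.
move=> M.
have two0 : 2%:R != 0 :> k by rewrite ((pcharf0P _).1 char0).
have im2 := prim4_sq chi_x; set im := chi x 0 0 in im2.
have card8 : #|[set: 'D_8]| = 8 by rewrite (@card_dihedral 4).
have hz : ((x * y) ^+ 2 = 1)%g by dihedral hy hx hyxy.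
have hzxz : ((x * y) * x * (x * y) = x^-1)%g by dihedral hy hx hyxy.
have zgen : <<[set x; (x * y)%g]>>%g = [set: 'D_8]%g.
  apply/eqP; rewrite eqEsubset subsetT -hgen gen_subG; apply/subsetP => g /set2P[]->.
    by rewrite mem_gen // set21.
  have : (x^-1 * (x * y))%g \in <<[set x; (x * y)%g]>>%g.
    by rewrite groupM ?groupV // mem_gen ?set21 ?set22.
  by rewrite mulKg.
have chi2 : sq_repr chi x = (-1)%:M.
  apply/matrixP => i j; rewrite !ord1 mxE big_ord1 -/im im2 !mxE.
  by rewrite eqxx.
have [m0 t0] := central_module hy hx hyxy hgen two0 rho_irr.
have [_ t0'] := central_module hz hx hzxz zgen two0 rho_irr.
have [m1 t1] := rotation_module card8 hy hx hyxy hgen chi2.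
have [_ t1'] := rotation_module card8 hz hx hzxz zgen chi2.
have [m2 t2] := reflection_module card8 hy hx hyxy hgen ss_y ss_yx2.
have [m3 t3] := reflection_module card8 hy hx hyxy hgen se_y se_yx2.
have [m4 t4] := reflection_module card8 hz hx hzxz zgen ss_xy ss_xyx2.
have [m5 t5] := reflection_module card8 hz hx hzxz zgen se_xy se_xyx2.
pose M' (n : nat) : ydModule k 'D_8 :=
    match n with
    | 0 => ydsimple rho
    | 1 => ydsimple (sq_repr chi)
    | 2 => ydsimple sgnsgn_y
    | 3 => ydsimple sgneps_y
    | 4 => ydsimple sgnsgn_xy
    | _ => ydsimple sgneps_xy
    end%N.
have one0 : 1 != 0 :> k by apply: oner_neq0.
have N10 : -1 != 0 :> k by rewrite oppr_eq0.
have s0 := central_type_simple two0 t0.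
have s1 := rotation_type_simple card8 hy hx hyxy hgen t1.
have s2 := reflection_type_simple card8 hy hx hyxy hgen N10 t2.
have s3 := reflection_type_simple card8 hy hx hyxy hgen one0 t3.
have s4 := reflection_type_simple card8 hz hx hzxz zgen N10 t4.
have s5 := reflection_type_simple card8 hz hx hzxz zgen one0 t5.
split.
- case=> n hn; rewrite /M /=.
  case: n hn => [|[|[|[|[|[|//]]]]]] _.
  - exact: (conj s0 m0).
  - exact: (conj s1 m1).
  - exact: (conj s2 m2).
  - exact: (conj s3 m3).
  - exact: (conj s4 m4).
  exact: (conj s5 m5).
- move=> i j ij.
  exact: (modules_not_isomorphic two0 card8 hy hx hyxy hgen (M := M') t0 t1 t2 t3 t4 t5
    (ltn_ord i) (ltn_ord j) ij).
move=> i j l ij jl.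
exact: (triples_infinite char0 im2 hy hx hyxy (M := M') t0 t0' t1 t1' t2 t3 t4 t5
  ij jl (ltn_ord l)).
Qed.
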